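(* Let $n\geq 3$ be an integer and let $p\geq 2$. Let $\bar\gamma_{n,p}$ be the infimum of all real numbers $\gamma$ such that, for every $\varepsilon>0$, there is a constant $C_\varepsilon>0$ for which $$\Big\| \sup_{0<t\le R} |e^{it\Delta}f| \Big\|_{L^p(B^n(0,R))} \le C_\varepsilon R^{\varepsilon} R^{\gamma}\,\|f\|_{L^2(\mathbb{R}^n)}$$ holds for all $R>1$ and all $f\in L^2(\mathbb{R}^n)$ with $\operatorname{supp}\widehat f\subset B^n(0,1)$. Then the following two statements hold. (i) If $\bar\gamma_{n,p}=n\left(\frac1p-\frac{n}{2(n+1)}\right)$, then $$p\leq p_0(n):=2+\frac{4}{(n-1)(n+2)}.$$ (ii) If $\bar\gamma_{n,p}=0$, then $$p\geq p_1(n):=\max_{m\in\mathbb{Z},\,1\leq m\leq n}\left(2+\frac{4}{\,n-1+m+n/m\,}\right).$$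
   Context: $B^n(0,r)$ denotes the ball in $\mathbb{R}^n$ of radius $r$ centered at the origin. For $f$ on $\mathbb{R}^n$, the solution to the free Schr\''odinger equation $iu_t-\Delta u=0$ with $u(x,0)=f(x)$ is denoted $$e^{it\Delta}f(x)=(2\pi)^{-n/2}\int_{\mathbb{R}^n} e^{i(x\cdot\xi+t|\xi|^2)}\,\widehat f(\xi)\,d\xi,$$ where $\widehat f$ is the Fourier transform of $f$, with the normalization for which $e^{i0\Delta}f=f$. The constant $C_\varepsilon$ may depend on $\varepsilon$, $n$, $p$, $\gamma$ but not on $R$ or $f$. *)

(* Defs.v *)
From HB Require Import structures.
From mathcomp Require Import all_boot all_order all_algebra.
From mathcomp Require Import complex.
From mathcomp Require Import all_classical all_reals all_analysis.

Set Implicit Arguments.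
Unset Strict Implicit.
Unset Printing Implicit Defensive.

Import Order.TTheory GRing.Theory Num.Theory.
Import numFieldNormedType.Exports.

Local Open Scope classical_set_scope.
Local Open Scope ring_scope.

Section tuple_measure.
Context d (T : measurableType d) (R : realType).
Variable m : {sigma_finite_measure set T -> \bar R}.

Definition tcons n (z : T * n.-tuple T) : n.+1.-tuple T :=
  [the n.+1.-tuple T of z.1 :: z.2].

Lemma measurable_tcons n : measurable_fun setT (@tcons n).
Proof. exact: measurable_cons. Qed.

Section step.
Variables (n : nat) (mu : {sigma_finite_measure set (n.-tuple T) -> \bar R}).

Definition cons_measure : set (n.+1.-tuple T) -> \bar R :=
  pushforward (m \x mu)%E (@tcons n).

Let measurable_preimage_tcons (A : set (n.+1.-tuple T)) :
  measurable A -> measurable (@tcons n @^-1` A).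
Proof.
by move=> mA; rewrite -[X in measurable X]setTI; exact: measurable_tcons.
Qed.

Let cons_measure0 : cons_measure set0 = 0%E.
Proof. by rewrite /cons_measure /pushforward preimage_set0 measure0. Qed.

Let cons_measure_ge0 A : (0 <= cons_measure A)%E.
Proof. by rewrite /cons_measure /pushforward measure_ge0. Qed.

Let cons_measure_sigma_additive : semi_sigma_additive cons_measure.
Proof.
move=> F mF tF mUF; rewrite /cons_measure /pushforward preimage_bigcup.
apply: measure_semi_sigma_additive.
- by move=> k; exact: measurable_preimage_tcons.
- apply/trivIsetP => /= i j _ _ ij; rewrite -preimage_setI.
  by move/trivIsetP : tF => /(_ _ _ _ _ ij) ->//; rewrite preimage_set0.
- by rewrite -preimage_bigcup; exact: measurable_preimage_tcons.
Qed.

HB.instance Definition _ := isMeasure.Build _ _ _ cons_measure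
  cons_measure0 cons_measure_ge0 cons_measure_sigma_additive.

Let cons_measure_sigma_finite : sigma_finite setT cons_measure.
Proof.
have /sigma_finiteP[F [TF ndF Foo]] := sigma_finiteT m.
have /sigma_finiteP[G [TG ndG Goo]] := sigma_finiteT mu.
pose u (x : n.+1.-tuple T) : T * n.-tuple T := (thead x, [tuple of behead x]).
have mu_ : measurable_fun setT u.
  apply: measurable_fun_pair; first exact: measurable_tnth.
  exact: measurable_behead.
have tK z : u (tcons z) = z.
  by case: z => a b; rewrite /u /tcons; congr pair; apply/val_inj.
exists (fun k => u @^-1` (F k `*` G k)).
  rewrite -preimage_bigcup (_ : \bigcup_k _ = setT) ?preimage_setT//.
  rewrite -setXTT TF TG predeqE => -[x y]; split.
    by move=> [k _ [/= ? ?]]; split; exists k.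
  move=> [/= [i _ Fx] [j _ Gy]]; exists (maxn i j) => //; split.
  - by move: x Fx; exact/subsetPset/ndF/leq_maxl.
  - by move: y Gy; exact/subsetPset/ndG/leq_maxr.
move=> k; have [mF Fk] := Foo k; have [mG Gk] := Goo k; split.
  by rewrite -[X in measurable X]setTI; apply: mu_ => //; exact: measurableX.
rewrite /cons_measure /pushforward -comp_preimage.
rewrite (_ : u \o @tcons n = id); last by apply/funext => z /=; exact: tK.
by rewrite preimage_id product_measure1E// lte_mul_pinfty// ge0_fin_numE.
Qed.

HB.instance Definition _ :=
  Measure_isSigmaFinite.Build _ _ _ cons_measure cons_measure_sigma_finite.

End step.

Fixpoint tuple_measure n : {sigma_finite_measure set (n.-tuple T) -> \bar R} :=
  match n with
  | 0 => \d_([tuple] : 0.-tuple T)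
  | k.+1 => cons_measure (tuple_measure k)
  end.

End tuple_measure.

Notation Rn R n := (n.-tuple (measurableTypeR R)).

Definition lebesgue_Rn (R : realType) (n : nat) :
    {sigma_finite_measure set (Rn R n) -> \bar R} :=
  tuple_measure lebesgue_measure n.

Section euclidean.
Context {R : realType} {n : nat}.
Implicit Types x y : n.-tuple R.

Definition dot x y : R := \sum_(i < n) tnth x i * tnth y i.

Definition edist x y : R :=
  Num.sqrt (\sum_(i < n) (tnth x i - tnth y i) ^+ 2).

Definition eball x (r : R) : set (Rn R n) := [set y | edist y x < r].

Definition origin : Rn R n := [tuple 0 | i < n].

End euclidean.
Arguments origin {R n}.

Section complex_functions.
Context {R : realType} {n : nat}.
Notation mu := (lebesgue_Rn R n).
Implicit Types f g : Rn R n -> R[i].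

Definition cmeasurable f :=
  measurable_fun setT (fun x => complex.Re (f x)) /\
  measurable_fun setT (fun x => complex.Im (f x)).

Definition cLnorm (p : \bar R) f : \bar R :=
  Lnorm mu p (fun x => (Normc.normc (f x))%:E).

Definition in_Lp (p : \bar R) f := cmeasurable f /\ (cLnorm p f < +oo)%E.

Definition cintegral f : R[i] :=
  (Rintegral mu setT (fun x => complex.Re (f x))
   +i* Rintegral mu setT (fun x => complex.Im (f x)))%C.

Definition expi (a : R) : R[i] := (cos a +i* sin a)%C.

Definition fourier_cst : R[i] := ((2 * pi) `^ (- (n%:R / 2)))%:C%C.

Definition fourierL1 f (xi : Rn R n) : R[i] :=
  fourier_cst * cintegral (fun x => expi (- dot x xi) * f x).

(* [g] is the Fourier transform of [f] in L^2: the continuous extension to L^2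
   of the integral transform on the dense subspace of L^1 /\ L^2. *)
Definition is_fourier f g :=
  [/\ in_Lp 2%:E f, in_Lp 2%:E g &
    exists F : nat -> Rn R n -> R[i],
      [/\ forall k, in_Lp 1%:E (F k) /\ in_Lp 2%:E (F k),
          cLnorm 2%:E (fun x => F k x - f x) @[k --> \oo] --> 0%E &
          cLnorm 2%:E (fun xi => fourierL1 (F k) xi - g xi)
            @[k --> \oo] --> 0%E]].

(* Support of the class of [g] modulo null sets: the complement of the largest
   open set on which [g] vanishes almost everywhere. *)
Definition ess_supp g : set (Rn R n) :=
  [set xi | forall e : R, 0 < e ->
    (0 < mu (eball xi e `&` [set eta | g eta != 0%R]))%E].

(* [exp(i t Delta) f] as a function of the Fourier transform [fhat] of [f] *)
Definition schrodinger (fhat : Rn R n -> R[i]) (t : R) (x : Rn R n) : R[i] :=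
  fourier_cst *
  cintegral (fun xi => expi (dot x xi + t * dot xi xi) * fhat xi).

Definition schrodinger_max fhat (r : R) (x : Rn R n) : \bar R :=
  ereal_sup [set (Normc.normc (schrodinger fhat t x))%:E | t in `]0, r]].

End complex_functions.

Section exponents.
Context {R : realType}.

Definition maximal_estimate (n : nat) (p gamma : R) : Prop :=
  forall eps : R, 0 < eps -> exists2 C : R, 0 < C &
    forall (r : R) (f fhat : Rn R n -> R[i]),
      1 < r -> is_fourier f fhat -> ess_supp fhat `<=` eball origin 1 ->
      ('N[lebesgue_Rn R n]_(p%:E) [schrodinger_max fhat r \_ (eball origin r)]
         <= (C * r `^ eps * r `^ gamma)%:E * cLnorm 2%:E f)%E.

(* The infimum is taken in the extended reals, where an empty or unbounded set
   of exponents does not produce a finite value. *)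
Definition gamma_bar (n : nat) (p : R) : \bar R :=
  ereal_inf [set gamma%:E | gamma in maximal_estimate n p].

Definition p0 (n : nat) : R := 2 + 4 / ((n%:R - 1) * (n%:R + 2)).

Definition p1_term (n m : nat) : R := 2 + 4 / (n%:R - 1 + m%:R + n%:R / m%:R).

Definition p1 (n : nat) : R :=
  \big[Num.max/p1_term n 1]_(1 <= m < n.+1) p1_term n m.

End exponents.

(* Main.v *)
(* Every exponent gamma of the maximal estimate satisfies, for 1 <= m <= n,
     gamma >= m / (2 (m + 1)) - (n + m) / 2 * (1/2 - 1/p);
   m = n - 1 gives (i) and letting m vary gives (ii).
   The test function is a tensor product whose Fourier transform is nonnegative:
   one coordinate carries a moving wave packet of width R^(1/2), n - m coordinates
   carry a resting packet of that width, and N = m - 1 coordinates carry M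
   frequencies in arithmetic progression of step D ~ 1 / M, where
   R = M^(2 (N + 2)).  At the times t = 2 pi k / D^2 the solution is large at the
   points of a lattice of step 2 pi / D, translated by -2 t th_j in the j-th lattice
   coordinate.  Taking th_j proportional to D / B^j with B = 32 M, the translations
   reached by B^N consecutive values of k run through all N-digit numbers in base
   B, so that every point of a large box is within 1 / B of the lattice (relative
   to its step) at a time when the moving packet passes over it; no Gauss sum is
   needed.  There all the phases are aligned, and the solution is comparable to the
   integral of the Fourier transform of the datum. *)
From HB Require Import structures.
From mathcomp Require Import all_boot all_order all_algebra.
From mathcomp Require Import complex ring lra.
From mathcomp Require Import all_classical all_reals all_analysis measurable_realfun.
Require Import Defs.

Set Implicit Arguments.
Unset Strict Implicit.
Unset Printing Implicit Defensive.

Import Order.TTheory GRing.Theory Num.Theory.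
Import numFieldNormedType.Exports.

Local Open Scope classical_set_scope.
Local Open Scope ring_scope.

(** * Integrals on the real line *)

Section real_line.
Context {R : realType}.
Notation mu := (@lebesgue_measure R).
Implicit Types f g : measurableTypeR R -> R.

Definition intg f := mu.-integrable setT (EFin \o f).
Definition Int f := Rintegral mu setT f.

(** Reduces to the measurability of real powers. The square makes the base nonnegative, and at a
    zero of [f] both sides are 0. *)
Lemma measurable_funV d (T : measurableType d) (f : T -> R) :
  measurable_fun setT f -> measurable_fun setT (fun x => (f x)^-1).
Proof.
move=> mf; rewrite (_ : (fun _ => _) =
    (fun x => f x * (f x ^+ 2) `^ (-1))); last first.
  apply/funext => x; rewrite powR_inv1 ?sqr_ge0//.
  by have [->|x0] := eqVneq (f x) 0; [rewrite invr0 mul0r|field].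
apply: measurable_funM => //.
apply: (@measurableT_comp _ _ _ _ _ _ (fun x : R => x `^ (-1)) _ (fun x => f x ^+ 2)).
  exact: measurable_powR.
exact: measurable_funX.
Qed.

Lemma intg_mfun f : intg f -> measurable_fun setT f.
Proof. by move=> /integrableP[/measurable_EFinP]. Qed.

Lemma measurable_affine (a b : R) :
  measurable_fun setT (fun x : measurableTypeR R => a * x + b : measurableTypeR R).
Proof.
by apply: measurable_funD => //; apply: measurable_funM => //; exact: measurable_id.
Qed.

(** Uniqueness of Lebesgue measure: [|a|] times the image measure gives every half-open interval its
    length. *)
Lemma mu_affine (a b : R) (A : set (measurableTypeR R)) : a != 0 -> measurable A ->
  mu ((fun x : measurableTypeR R => a * x + b) @^-1` A) = (`|a|^-1%:E * mu A)%E.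
Proof.
move=> a0 mA.
have aNN : 0 <= `|a| by [].
pose k : {nonneg R} := NngNum aNN.
have mf := measurable_affine a b.
have := @lebesgue_measure_unique R (mscale k (pushforward mu
  (fun x : measurableTypeR R => a * x + b : measurableTypeR R))).
move=> H; rewrite [in RHS]H//.
  rewrite /mscale/= /pushforward muleA -EFinM mulVf ?normr_eq0// mul1e//.
move=> _ [[u v]] _ <-; rewrite /= /mscale/= /pushforward.
have [a_gt0|a_lt0|/eqP] := ltgtP 0 a; last by rewrite eq_sym (negbTE a0).
- rewrite (_ : _ @^-1` _ = `](u - b) / a, (v - b) / a]%classic); last first.
    apply/seteqP; split => x/=; rewrite !in_itv/=.
    + by move=> /andP[ux xv]; rewrite ltr_pdivrMr// ler_pdivlMr//; apply/andP; split; lra.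
    + by rewrite ltr_pdivrMr// ler_pdivlMr// => /andP[ux xv]; apply/andP; split; lra.
  rewrite !lebesgue_measure_itv/= !lte_fin gtr0_norm//.
  have -> : ((u - b) / a < (v - b) / a) = (u < v).
    by rewrite ltr_pM2r ?invr_gt0// ltrD2r.
  case: ifPn => _; last by rewrite mule0.
  by rewrite -!EFinB -EFinM; congr EFin; field.
(* A negative slope exchanges the open and the closed end, which does not change the length. *)
- rewrite (_ : _ @^-1` _ = `[(v - b) / a, (u - b) / a[%classic); last first.
    apply/seteqP; split => x/=; rewrite !in_itv/=.
    + by move=> /andP[ux xv]; rewrite ltr_ndivlMr// ler_ndivrMr//; apply/andP; split; lra.
    + by rewrite ltr_ndivlMr// ler_ndivrMr// => /andP[ux xv]; apply/andP; split; lra.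
  rewrite !lebesgue_measure_itv/= !lte_fin ltr0_norm//.
  have -> : ((v - b) / a < (u - b) / a) = (u < v).
    by rewrite ltr_nM2r ?invr_lt0// ltrD2r.
  case: ifPn => _; last by rewrite mule0.
  by rewrite -!EFinB -EFinM; congr EFin; field.
Qed.

Lemma ge0_integral_affine (a b : R) (f : measurableTypeR R -> \bar R) : a != 0 ->
  measurable_fun setT f -> (forall x, 0 <= f x)%E ->
  (\int[mu]_x f (a * x + b)%R = `|a|^-1%:E * \int[mu]_x f x)%E.
Proof.
move=> a0 mf f0.
have aNN : 0 <= `|a|^-1 by rewrite invr_ge0.
pose k : {nonneg R} := NngNum aNN.
have -> : (`|a|^-1%:E * \int[mu]_x f x = \int[mscale k mu]_x f x)%E.
  by rewrite ge0_integral_mscale.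
transitivity (\int[pushforward mu
    (fun x : measurableTypeR R => (a * x + b)%R : measurableTypeR R)]_x f x)%E.
  by rewrite ge0_integral_pushforward//; exact: measurable_affine.
apply: eq_measure_integral; first exact: measurable_affine.
move=> mab A mA _.
by rewrite [LHS](mu_affine b a0 mA).
Qed.


Lemma intg_affine (a b : R) f : a != 0 -> intg f -> intg (fun x => f (a * x + b)).
Proof.
move=> a0 /integrableP[mf If]; apply/integrableP; split.
  by apply: (measurableT_comp mf); exact: measurable_affine.
have := @ge0_integral_affine a b (fun x => `|(EFin \o f) x|%E) a0.
rewrite /= => ->//; last first.
  by apply/measurable_EFinP; apply: measurableT_comp => //; exact/measurable_EFinP.
by apply: lte_mul_pinfty => //; rewrite lee_fin invr_ge0.
Qed.

Lemma Int_affine (a b : R) f : a != 0 -> intg f ->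
  Int (fun x => f (a * x + b)) = `|a|^-1 * Int f.
Proof.
move=> a0 fi; have := intg_affine b a0 fi => fabi.
have mf : measurable_fun setT (EFin \o f) by case/integrableP : fi.
have affp := ge0_integral_affine b a0 (measurable_funepos mf) (fun=> funepos_ge0 _ _).
have affn := ge0_integral_affine b a0 (measurable_funeneg mf) (fun=> funeneg_ge0 _ _).
rewrite /Int /Rintegral [in LHS]integralE [in RHS]integralE.
transitivity (fine (`|a|^-1%:E * \int[mu]_x (EFin \o f)^\+ x -
                    `|a|^-1%:E * \int[mu]_x (EFin \o f)^\- x)%E).
  by congr (fine (_ - _)%E); [rewrite -affp|rewrite -affn]; apply: eq_integral => x _;
    rewrite ?funeposE ?funenegE.
have pf := integrable_fin_num measurableT (integrable_funepos measurableT fi).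
have nf := integrable_fin_num measurableT (integrable_funeneg measurableT fi).
by rewrite -(fineK pf) -(fineK nf) -!EFinM -!EFinB /= mulrBr.
Qed.

Lemma eq_Int f g : f =1 g -> Int f = Int g.
Proof. by move=> /funext ->. Qed.

Lemma IntD f g : intg f -> intg g -> Int (fun x => f x + g x) = Int f + Int g.
Proof. by move=> fi gi; rewrite /Int RintegralD. Qed.

Lemma IntB f g : intg f -> intg g -> Int (fun x => f x - g x) = Int f - Int g.
Proof. by move=> fi gi; rewrite /Int RintegralB. Qed.

Lemma IntZ (c : R) f : intg f -> Int (fun x => c * f x) = c * Int f.
Proof. by move=> fi; rewrite /Int RintegralZl. Qed.

Lemma intgD f g : intg f -> intg g -> intg (fun x => f x + g x).
Proof. by move=> fi gi; have := integrableD measurableT fi gi. Qed.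

Lemma intgB f g : intg f -> intg g -> intg (fun x => f x - g x).
Proof. by move=> fi gi; have := integrableB measurableT fi gi. Qed.

Lemma intgZ (c : R) f : intg f -> intg (fun x => c * f x).
Proof. by move=> fi; have := integrableZl measurableT c fi. Qed.

Lemma le_intg f g : measurable_fun setT f -> (forall x, `|f x| <= g x) ->
  intg g -> intg f.
Proof.
move=> mf fg; apply: le_integrable => //; first exact/measurable_EFinP.
by move=> x _; rewrite /= lee_fin (le_trans (fg x))// ler_norm.
Qed.

Lemma le_Int f g : intg f -> intg g -> (forall x, f x <= g x) -> Int f <= Int g.
Proof. by move=> fi gi fg; apply: le_Rintegral => // x _. Qed.

Lemma intg_sum (I : Type) (s : seq I) (h : I -> measurableTypeR R -> R) :
  (forall i, intg (h i)) -> intg (fun x => \sum_(i <- s) h i x).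
Proof.
move=> hi; rewrite /intg (_ : EFin \o _ = fun x => \sum_(i <- s) (h i x)%:E)%E.
  by apply: (integrable_sum measurableT) => i _; exact: hi.
by apply/funext => x /=; rewrite sumEFin.
Qed.

Lemma Int_sum (I : Type) (s : seq I) (h : I -> measurableTypeR R -> R) :
  (forall i, intg (h i)) ->
  Int (fun x => \sum_(i <- s) h i x) = \sum_(i <- s) Int (h i).
Proof.
move=> hi; elim: s => [|i s ih].
  under eq_Int do rewrite big_nil.
  by rewrite big_nil /Int /Rintegral integral0.
under eq_Int do rewrite big_cons.
by rewrite big_cons -ih IntD//; exact: intg_sum.
Qed.

(** The reference majorant on the line. Evenness reduces it to the arctangent integral over the
    half-line. *)
Lemma intg_oneDsqr : intg (fun x => (1 + x ^+ 2)^-1).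
Proof.
apply/integrableP; split.
  apply/measurable_EFinP; apply: continuous_measurable_fun.
  exact: (@continuous_oneDsqrV R).
under eq_integral => x _ do
  rewrite /= ger0_norm ?invr_ge0 ?addr_ge0 ?ler01 ?sqr_ge0//.
rewrite (ge0_symfun_integralT (f := fun x : R => (1 + x ^+ 2)^-1)).
- rewrite -set_itvcy -[X in (_ * X)%E]/(\int[mu]_(x in `[0%R, +oo[) ((oneDsqr x)^-1)%:E)%E.
  by rewrite integral0y_oneDsqr -EFinM ltry.
- by move=> x; rewrite invr_ge0 addr_ge0 ?sqr_ge0.
- exact: (@continuous_oneDsqrV R).
- by move=> x /=; rewrite sqrrN.
Qed.

Lemma intg_dom (C : R) f : measurable_fun setT f ->
  (forall x, `|f x| <= C / (1 + x ^+ 2)) -> intg f.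
Proof. by move=> mf fC; apply: (le_intg mf fC); apply: intgZ; exact: intg_oneDsqr. Qed.

Lemma Int_odd f : (forall x, f (- x) = - f x) -> intg f -> Int f = 0.
Proof.
move=> fN fi; have := @Int_affine (-1) 0 f; rewrite oppr_eq0 oner_eq0 => /(_ isT fi).
rewrite normrN normr1 invr1 mul1r.
rewrite (@eq_Int _ (fun x => -1 * f x)); last by move=> x; rewrite addr0 !mulN1r.
by rewrite IntZ// => ?; lra.
Qed.

End real_line.

(** * The Fejer kernel and its Fourier transform *)

Section fejer_kernel.
Context {R : realType}.
Notation mu := (@lebesgue_measure R).
Implicit Types a x : R.

Lemma sin_le_norm x : `|sin x| <= `|x|.
Proof.
wlog x0 : x / 0 < x => [H|].
  have [/H//|x_lt0|<-] := ltgtP 0 x; last by rewrite sin0.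
  by rewrite -normrN -[leRHS]normrN -sinN; apply: H; rewrite oppr_gt0.
have [|c _] := @MVT R sin cos 0 x x0 (fun y _ => is_derive_sin y).
  by apply: continuous_subspaceT => y; exact: continuous_sin.
rewrite sin0 !subr0 => ->; rewrite normrM ler_piMl//; exact: cos_max.
Qed.

Lemma one_sub_cos x : 1 - cos x = 2 * sin (x / 2) ^+ 2.
Proof.
have {1}-> : x = (x / 2) *+ 2 by rewrite -mulr_natr; field.
by rewrite cos_mulr2n; have := cos2Dsin2 (x / 2); lra.
Qed.

Lemma one_sub_cos_ge0 x : 0 <= 1 - cos x.
Proof. by rewrite subr_ge0 cos_le1. Qed.

Lemma one_sub_cos_le x : 1 - cos x <= x ^+ 2 / 2.
Proof.
rewrite one_sub_cos.
have : sin (x / 2) ^+ 2 <= (x / 2) ^+ 2.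
  rewrite -(real_normK (num_real (sin _))) -(real_normK (num_real (x / 2))).
  by rewrite lerXn2r ?nnegrE//; exact: sin_le_norm.
lra.
Qed.

Lemma sub_sin_le x : 0 <= x -> 0 <= x - sin x <= x ^+ 3 / 2.
Proof.
rewrite le_eqVlt => /predU1P[<-|x0]; first by rewrite sin0 expr0n/= mul0r subr0 lexx.
have [|c] := @MVT R sin cos 0 x x0 (fun y _ => is_derive_sin y).
  by apply: continuous_subspaceT => y; exact: continuous_sin.
rewrite in_itv/= => /andP[c0 cx]; rewrite sin0 !subr0 => ->.
have -> : x - cos c * x = (1 - cos c) * x by ring.
rewrite mulr_ge0 ?one_sub_cos_ge0 ?(ltW x0)//=.
apply: (@le_trans _ _ ((c ^+ 2 / 2) * x)).
  by rewrite ler_wpM2r ?one_sub_cos_le ?ltW.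
have : c ^+ 2 <= x ^+ 2 by rewrite lerXn2r ?nnegrE ?ltW.
by move=> h; rewrite (_ : x ^+ 3 / 2 = x ^+ 2 / 2 * x); [rewrite ler_pM2r//; lra|ring].
Qed.

(** With [s = sin (x / 2)] the quantity is [2 * (x / 2 - s) * (x / 2 + s)], and [sub_sin_le]
    controls the first factor. *)
Lemma cos_taylor4 x : 0 <= cos x - 1 + x ^+ 2 / 2 <= x ^+ 4 / 8.
Proof.
apply/andP; split; first by have := one_sub_cos_le x; lra.
wlog x0 : x / 0 <= x => [H|].
  by have [/H//|/ltW x0] := leP 0 x; have := H (- x);
    rewrite oppr_ge0 cosN sqrrN (_ : (- x) ^+ 4 = x ^+ 4); [exact|ring].
have y0 : 0 <= x / 2 by rewrite divr_ge0.
have /andP[s1 s2] := sub_sin_le y0.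
have : (x / 2 - sin (x / 2)) * (x / 2 + sin (x / 2)) <= (x / 2) ^+ 3 / 2 * (2 * (x / 2)).
  have s3 : - (x / 2) <= sin (x / 2).
    by have := sin_le_norm (x / 2); rewrite (ger0_norm y0) ler_norml => /andP[].
  by apply: ler_pM => //; lra.
have := one_sub_cos x; set s := sin _ => e.
have -> : cos x = 1 - 2 * s ^+ 2 by rewrite -e; lra.
by move=> h; apply: le_trans (_ : _ <= 2 * ((x / 2) ^+ 3 / 2 * (2 * (x / 2)))) _; nra.
Qed.

(* Division makes [fejer 0 = 0] instead of [1 / 2], which is harmless in integrals. *)
Definition fejer x : R := (1 - cos x) / x ^+ 2.

(* This form is the second difference of [`|x|] produced by [Int_cos_gap];
   see [tentE] for the usual one. *)
Definition tent x : R := (`|x + 1| + `|x - 1|) / 2 - `|x|.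

Lemma fejer_ge0 x : 0 <= fejer x.
Proof. by rewrite divr_ge0 ?one_sub_cos_ge0 ?sqr_ge0. Qed.

(** The bound near the origin and the bound at infinity add up to [u * (1 + x ^+ 2) <= 2 * C]. *)
Lemma decay_bound (C x u : R) : 0 <= C -> 0 <= u <= C -> u * x ^+ 2 <= C ->
  `|u| <= (2 * C) / (1 + x ^+ 2).
Proof.
move=> C0 /andP[u0 uC] ux; rewrite ger0_norm// ler_pdivlMr; last first.
  by rewrite ltr_pwDl ?sqr_ge0.
by rewrite mulrDr; lra.
Qed.

Lemma fejer_le x : fejer x <= 2^-1.
Proof.
rewrite /fejer; have [->|x0] := eqVneq x 0; first by rewrite expr0n invr0 mulr0.
rewrite ler_pdivrMr ?exprn_even_gt0//; have := one_sub_cos_le x; lra.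
Qed.

Lemma fejer_decay x : fejer x * x ^+ 2 <= 2.
Proof.
rewrite /fejer; have [->|x0] := eqVneq x 0; first by rewrite expr0n mulr0.
by rewrite mulfVK ?expf_neq0//; have := cos_geN1 x; lra.
Qed.

Lemma measurable_cosM a : measurable_fun setT (fun x : measurableTypeR R => cos (a * x)).
Proof.
apply: continuous_measurable_fun => x; apply: continuous_comp.
  exact: mulrl_continuous.
exact: continuous_cos.
Qed.

Lemma measurable_sinM a : measurable_fun setT (fun x : measurableTypeR R => sin (a * x)).
Proof.
apply: continuous_measurable_fun => x; apply: continuous_comp.
  exact: mulrl_continuous.
exact: continuous_sin.
Qed.

Lemma measurable_fejer : measurable_fun setT (fejer : measurableTypeR R -> R).
Proof.
apply: measurable_funM.
  apply: measurable_funB => //; have := measurable_cosM 1.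
  by under eq_fun do rewrite mul1r.
by apply: measurable_funV; exact: measurable_funX.
Qed.

Lemma intg_fejer : intg fejer.
Proof.
apply: (@intg_dom _ (2 * 2)); first exact: measurable_fejer.
move=> x; apply: decay_bound; rewrite ?fejer_ge0 ?fejer_decay//=.
by rewrite (le_trans (fejer_le x))//; lra.
Qed.

Definition fejer_mass : R := Int fejer.

Lemma intg_itvoc (u v : R) : intg (\1_(`]u, v]%classic) : measurableTypeR R -> R).
Proof. exact: (@integrable_indic_itv R u v false false). Qed.

Lemma Int_itvoc (u v : R) : u <= v ->
  Int (\1_(`]u, v]%classic) : measurableTypeR R -> R) = v - u.
Proof.
move=> uv; rewrite /Int /Rintegral integral_indic// setIT.
rewrite [X in fine X](_ : _ = if (u%:E < v%:E)%E then (v - u)%:E else 0%E); last first.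
  by rewrite -[LHS]/(mu `]u, v]%classic) lebesgue_measure_itv.
rewrite lte_fin; move: uv; rewrite le_eqVlt => /predU1P[->|->]//.
by rewrite ltxx subrr.
Qed.

Lemma Int_lower_bound (u v c : R) (f : measurableTypeR R -> R) : u <= v ->
  intg f -> (forall x, 0 <= f x) -> (forall x, u < x <= v -> c <= f x) ->
  c * (v - u) <= Int f.
Proof.
move=> uv fi f0 cf; rewrite -(Int_itvoc uv) -IntZ; last exact: intg_itvoc.
apply: le_Int => //; first by apply: intgZ; exact: intg_itvoc.
move=> x; rewrite indicE; case: (boolP (_ \in _)) => [|_]; last by rewrite mulr0.
by rewrite inE/= in_itv/= mulr1 => /cf.
Qed.

Lemma fejer_mass_gt0 : 0 < fejer_mass.
Proof.
(* On []0, 1]] the kernel is at least [1 / 2 - x ^+ 2 / 8], hence at least [3 / 8]. *)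
apply: lt_le_trans (_ : 3 / 8 * (1 - 0) <= _); first by lra.
apply: Int_lower_bound => //; [exact: intg_fejer|exact: fejer_ge0|].
move=> x /andP[x0 x1]; have /andP[_ h] := cos_taylor4 x.
rewrite /fejer ler_pdivlMr ?exprn_gt0//.
have : x ^+ 4 <= x ^+ 2 by rewrite ler_wiXn2l// ltW.
lra.
Qed.

(** The summand [0] gives the argument the shape that [Int_affine] expects; the later rescalings
    carry it for the same reason. *)
Lemma cos_gap_scale a x : (1 - cos (a * x)) / x ^+ 2 = a ^+ 2 * fejer (a * x + 0).
Proof.
rewrite /fejer addr0; have [->|a0] := eqVneq a 0.
  by rewrite !mul0r cos0 subrr !mul0r mulr0.
have [->|x0] := eqVneq x 0; last by field; rewrite a0 x0.
by rewrite mulr0 expr0n/= invr0 !mulr0.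
Qed.

Lemma intg_cos_gap a : intg (fun x => (1 - cos (a * x)) / x ^+ 2).
Proof.
under eq_fun do rewrite cos_gap_scale.
have [->|a0] := eqVneq a 0; last by apply/intgZ/intg_affine => //; exact: intg_fejer.
under eq_fun do rewrite expr0n mul0r.
by have := intgZ 0 intg_fejer; under eq_fun do rewrite mul0r.
Qed.

(* By scaling, a multiple of [`|a|]: no Fourier inversion is needed, and the
   numerical value [pi] of [fejer_mass] is irrelevant. *)
Lemma Int_cos_gap a :
  Int (fun x => (1 - cos (a * x)) / x ^+ 2) = `|a| * fejer_mass.
Proof.
under eq_Int do rewrite cos_gap_scale.
have [->|a0] := eqVneq a 0.
  rewrite normr0 mul0r; transitivity (Int (fun x : measurableTypeR R => 0 * fejer x)).
    by apply: eq_Int => x; rewrite expr0n !mul0r.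
  by rewrite IntZ ?mul0r//; exact: intg_fejer.
rewrite IntZ ?Int_affine//; try exact: intg_fejer; last first.
  by apply: intg_affine => //; exact: intg_fejer.
rewrite mulrA; congr (_ * _); rewrite -[a ^+ 2]ger0_norm ?sqr_ge0// normrX.
by field; rewrite normr_eq0.
Qed.

(** Product-to-sum formula: a second difference in [a] of [cos (a * x)]. Its coefficients sum to 0,
    so each cosine can be replaced by [1 - cos], which makes every term integrable. *)
Lemma fejer_cosE a x : fejer x * cos (a * x) =
  2^-1 * ((1 - cos ((a + 1) * x)) / x ^+ 2) +
  2^-1 * ((1 - cos ((a - 1) * x)) / x ^+ 2) - (1 - cos (a * x)) / x ^+ 2.
Proof.
rewrite (mulrBl x a) (mulrDl a) mul1r !cosD cosN sinN /fejer.
have [->|x0] := eqVneq x 0; first by rewrite expr0n invr0; ring.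
by field.
Qed.

Lemma intg_fejer_cos a : intg (fun x => fejer x * cos (a * x)).
Proof.
under eq_fun do rewrite fejer_cosE.
by apply: intgB; first apply: intgD; try apply: intgZ; exact: intg_cos_gap.
Qed.

(** By [Int_cos_gap] the second difference of cosines integrates to the second difference of [|a|].
    Together with [Int_fejer_sin] this is the Fourier transform of the kernel. *)
Lemma Int_fejer_cos a : Int (fun x => fejer x * cos (a * x)) = fejer_mass * tent a.
Proof.
under eq_Int do rewrite fejer_cosE.
have h b := intgZ 2^-1 (intg_cos_gap b).
rewrite IntB ?IntD ?IntZ ?Int_cos_gap//; try exact: intg_cos_gap; last exact: intgD.
by rewrite /tent; field.
Qed.

Lemma intg_fejer_sin a : intg (fun x => fejer x * sin (a * x)).
Proof.
apply: (le_intg _ _ intg_fejer).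
  by apply: measurable_funM; [exact: measurable_fejer|exact: measurable_sinM].
move=> x; rewrite normrM (ger0_norm (fejer_ge0 _)) ler_piMr ?fejer_ge0//.
exact: sin_max.
Qed.

Lemma Int_fejer_sin a : Int (fun x => fejer x * sin (a * x)) = 0.
Proof.
apply: Int_odd; last exact: intg_fejer_sin.
by move=> x; rewrite /fejer cosN sqrrN mulrN sinN mulrN.
Qed.

(* The analogue for [fejer ^+ 2] of the function [(1 - cos x) / x ^+ 2]:
   the integral of [x |-> gap4 (a * x) * a ^+ 4] is proportional to [`|a| ^+ 3]. *)
Definition gap4 x : R := (cos x - 1 + x ^+ 2 / 2) / x ^+ 4.

Lemma intg_gap4 : intg gap4.
Proof.
apply: (@intg_dom _ (2 * 2^-1)).
  apply: measurable_funM; last by apply: measurable_funV; exact: measurable_funX.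
  apply: measurable_funD; last first.
    by apply: measurable_funM => //; exact: measurable_funX.
  apply: measurable_funB => //; have := measurable_cosM 1.
  by under eq_fun do rewrite mul1r.
move=> x; have /andP[h1 h2] := cos_taylor4 x.
have [->|x0] := eqVneq x 0.
  by rewrite /gap4 (expr0n _ 4)/= invr0 mulr0 normr0 divr_ge0 ?mulr_ge0 ?addr_ge0 ?sqr_ge0.
have x4 : 0 < x ^+ 4 by rewrite exprn_even_gt0.
apply: decay_bound => //.
  rewrite divr_ge0//= ?exprn_even_ge0// /gap4 ler_pdivrMr//; lra.
rewrite (_ : gap4 x * _ = (cos x - 1 + x ^+ 2 / 2) / x ^+ 2); last first.
  by rewrite /gap4; field.
have x2 : 0 < x ^+ 2 by rewrite exprn_even_gt0.
by rewrite ler_pdivrMr//; have := cos_le1 x; lra.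
Qed.

Lemma gap4_scale a x :
  (cos (a * x) - 1 + (a * x) ^+ 2 / 2) / x ^+ 4 = a ^+ 4 * gap4 (a * x + 0).
Proof.
rewrite /gap4 addr0; have [->|a0] := eqVneq a 0.
  by rewrite !mul0r cos0 subrr !expr0n/= !mul0r addr0 mul0r.
have [->|x0] := eqVneq x 0; last by field; rewrite a0 x0.
by rewrite mulr0 !(expr0n _ 4)/= invr0 !mulr0.
Qed.

Lemma intg_gap4M a : intg (fun x => (cos (a * x) - 1 + (a * x) ^+ 2 / 2) / x ^+ 4).
Proof.
under eq_fun do rewrite gap4_scale.
have [->|a0] := eqVneq a 0; last by apply/intgZ/intg_affine => //; exact: intg_gap4.
under eq_fun do rewrite expr0n mul0r.
by have := intgZ 0 intg_gap4; under eq_fun do rewrite mul0r.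
Qed.

Lemma Int_gap4M a : Int (fun x => (cos (a * x) - 1 + (a * x) ^+ 2 / 2) / x ^+ 4) =
  `|a| ^+ 3 * Int gap4.
Proof.
under eq_Int do rewrite gap4_scale.
have [->|a0] := eqVneq a 0.
  rewrite normr0 (expr0n _ 3) mul0r.
  transitivity (Int (fun x : measurableTypeR R => 0 * gap4 x)).
    by apply: eq_Int => x; rewrite expr0n !mul0r.
  by rewrite IntZ ?mul0r//; exact: intg_gap4.
rewrite IntZ ?Int_affine//; try exact: intg_gap4; last first.
  by apply: intg_affine => //; exact: intg_gap4.
rewrite mulrA; congr (_ * _); rewrite -[a ^+ 4]ger0_norm ?exprn_even_ge0// normrX.
by field; rewrite normr_eq0.
Qed.

(** A fourth difference in [a] of [cos (a * x)], with coefficients [1, -4, 6, -4, 1] over 4. It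
    annihilates the quadratic Taylor polynomials subtracted in [g], which are there for
    integrability. *)
Lemma fejer2_cosE a x : fejer x ^+ 2 * cos (a * x) =
  let g b := (cos (b * x) - 1 + (b * x) ^+ 2 / 2) / x ^+ 4 in
  4^-1 * g (a + 2) - g (a + 1) + 3 / 2 * g a - g (a - 1) + 4^-1 * g (a - 2).
Proof.
have c2 : cos (2 * x) = 2 * cos x ^+ 2 - 1.
  by rewrite mulr_natl cos_mulr2n; ring.
rewrite /= !(mulrBl x a) !(mulrDl a) !mul1r !cosD !cosN !sinN c2 /fejer.
have [->|x0] := eqVneq x 0; first by rewrite !expr0n/= !invr0; ring.
by field.
Qed.

Lemma intg_fejer2_cos a : intg (fun x => fejer x ^+ 2 * cos (a * x)).
Proof.
under eq_fun do rewrite fejer2_cosE.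
apply: intgD; last exact/intgZ/intg_gap4M.
apply: intgB; last exact/intg_gap4M.
apply: intgD; last exact/intgZ/intg_gap4M.
by apply: intgB; [exact/intgZ/intg_gap4M|exact/intg_gap4M].
Qed.

(* The fourth difference of [`|a| ^+ 3] vanishes where no sign change occurs. *)
Lemma Int_fejer2_cos a : 2 <= `|a| -> Int (fun x => fejer x ^+ 2 * cos (a * x)) = 0.
Proof.
move=> a2; wlog a0 : a a2 / 0 <= a => [H|].
  have [/H->//|/ltW a0] := leP 0 a.
  rewrite -(H (- a)) ?normrN ?oppr_ge0//.
  by apply: eq_Int => x; rewrite mulNr cosN.
rewrite ger0_norm// in a2.
under eq_Int do rewrite fejer2_cosE.
have g b := intg_gap4M b; have zg k b := intgZ k (g b).
rewrite IntD//; last first.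
  by apply: intgB => //; apply: intgD => //; apply: intgB.
rewrite IntB//; last by apply: intgD => //; apply: intgB.
rewrite IntD//; last by apply: intgB.
rewrite IntB// !IntZ// !Int_gap4M.
by rewrite !ger0_norm; [field|lra..].
Qed.

Definition fejer2_mass : R := Int (fun x => fejer x ^+ 2).

(** * The tent function *)

Lemma tentE x : tent x = Num.max 0 (1 - `|x|).
Proof.
rewrite /tent; have [x0|x0] := leP 0 x.
  rewrite (@ger0_norm _ x)// (@ger0_norm _ (x + 1)); last by lra.
  have [x1|x1] := leP 1 x.
    by rewrite ger0_norm ?subr_ge0// max_l; lra.
  by rewrite ltr0_norm ?subr_lt0// max_r; lra.
rewrite (@ltr0_norm _ x)// (@ltr0_norm _ (x - 1)); last by lra.
have [x1|x1] := leP x (-1).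
  by rewrite ler0_norm; [rewrite max_l; lra|lra].
by rewrite gtr0_norm; [rewrite max_r; lra|lra].
Qed.

Lemma tent_ge0 x : 0 <= tent x.
Proof. by rewrite tentE le_max lexx. Qed.

Lemma tent_le1 x : tent x <= 1.
Proof. by rewrite tentE ge_max ler01/= gerBl. Qed.

Lemma tent_neq0 x : tent x != 0 -> `|x| < 1.
Proof.
move=> t0; rewrite ltNge; apply: contra_neqN t0 => x1.
by rewrite tentE max_l// subr_le0.
Qed.

Lemma intg_tent : intg tent.
Proof.
apply: (@intg_dom _ (2 * 1)).
  apply: measurable_funB; last exact: normr_measurable.
  apply: measurable_funM => //; apply: measurable_funD; apply: measurableT_comp => //.
    by apply: measurable_funD.
  by apply: measurable_funB.
move=> x; apply: decay_bound; rewrite ?tent_ge0 ?tent_le1//.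
have [->|/tent_neq0 x1] := eqVneq (tent x) 0; first by rewrite mul0r.
rewrite mulr_ile1 ?tent_ge0 ?sqr_ge0 ?tent_le1//.
by rewrite -[leLHS]ger0_norm ?sqr_ge0// normrX expr_le1// ltW.
Qed.

Definition tent_mass : R := Int tent.

Lemma tent_mass_gt0 : 0 < tent_mass.
Proof.
(* The tent is at least [1 / 2] on []0, 1 / 2]]. *)
apply: lt_le_trans (_ : 2^-1 * (2^-1 - 0) <= _); first by lra.
apply: Int_lower_bound; rewrite ?invr_ge0//; [exact: intg_tent|exact: tent_ge0|].
move=> x /andP[x0 x1]; rewrite tentE le_max (gtr0_norm x0); apply/orP; right; lra.
Qed.

End fejer_kernel.

(** * Tensor products *)

Section complex_integral.
Context d (T : measurableType d) (R : realType).
Implicit Types (mu : {measure set T -> \bar R}) (f g : T -> R[i]).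

(** Versions of [cmeasurable] and [cintegral] over an arbitrary measure space: the induction on the
    dimension passes through product spaces. *)
Definition cmeas f := measurable_fun setT (fun x => complex.Re (f x)) /\
  measurable_fun setT (fun x => complex.Im (f x)).

Definition cintg mu f :=
  mu.-integrable setT (fun x => (complex.Re (f x))%:E) /\
  mu.-integrable setT (fun x => (complex.Im (f x))%:E).

Definition cInt mu f : R[i] :=
  (Rintegral mu setT (fun x => complex.Re (f x))
   +i* Rintegral mu setT (fun x => complex.Im (f x)))%C.

Lemma cmeasM f g : cmeas f -> cmeas g -> cmeas (fun x => f x * g x).
Proof.
move=> [fr fi] [gr gi]; split.
- rewrite (_ : (fun _ => _) = fun x => complex.Re (f x) * complex.Re (g x) -
    complex.Im (f x) * complex.Im (g x)).
    by apply: measurable_funB; exact: measurable_funM.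
  by apply/funext => x; case: (f x) => ? ?; case: (g x).
- rewrite (_ : (fun _ => _) = fun x => complex.Re (f x) * complex.Im (g x) +
    complex.Im (f x) * complex.Re (g x)).
    by apply: measurable_funD; exact: measurable_funM.
  by apply/funext => x; case: (f x) => ? ?; case: (g x).
Qed.

Lemma cmeas_cst (c : R[i]) : cmeas (fun=> c).
Proof. by split; exact: measurable_cst. Qed.

Lemma cmeas_prod (I : Type) (s : seq I) (h : I -> T -> R[i]) :
  (forall i, cmeas (h i)) -> cmeas (fun x => \prod_(i <- s) h i x).
Proof.
move=> hi; elim: s => [|i s ih].
  by under eq_fun do rewrite big_nil; exact: cmeas_cst.
by under eq_fun do rewrite big_cons; exact: cmeasM.
Qed.

Lemma cintg_cmeas mu f : cintg mu f -> cmeas f.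
Proof.
by move=> [/integrableP[/measurable_EFinP mr _] /integrableP[/measurable_EFinP mi _]].
Qed.

End complex_integral.

Lemma cmeas_comp d1 d2 (T1 : measurableType d1) (T2 : measurableType d2)
    (R : realType) (phi : T1 -> T2) (f : T2 -> R[i]) :
  measurable_fun setT phi -> cmeas f -> cmeas (f \o phi).
Proof.
by move=> mphi [fr fi]; split; [exact: (measurableT_comp fr)|exact: (measurableT_comp fi)].
Qed.

Section product_integral.
Context d1 d2 (T1 : measurableType d1) (T2 : measurableType d2) (R : realType).
Variables (m1 : {sigma_finite_measure set T1 -> \bar R}).
Variables (m2 : {sigma_finite_measure set T2 -> \bar R}).

(** Tonelli: the iterated integral of the modulus is the product of two finite integrals. *)
Lemma integrable_tensor2 (u : T1 -> R) (v : T2 -> R) :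
  m1.-integrable setT (EFin \o u) -> m2.-integrable setT (EFin \o v) ->
  (m1 \x m2)%E.-integrable setT (fun z => (u z.1 * v z.2)%:E).
Proof.
move=> iu iv; have /integrableP[mu_ ui] := iu; have /integrableP[mv vi] := iv.
have muv : measurable_fun [set: T1 * T2] (fun z => (u z.1 * v z.2)%:E).
  apply/measurable_EFinP; apply: measurable_funM.
    by apply: (measurableT_comp (f := u)) => //; exact/measurable_EFinP.
  by apply: (measurableT_comp (f := v)) => //; exact/measurable_EFinP.
apply: (proj2 (integrable12ltyP m1 m2 muv)).
under eq_integral => x _.
  under eq_integral => y _ do rewrite /= normrM EFinM.
  rewrite ge0_integralZl//; last by apply/measurable_EFinP;
    apply: measurableT_comp => //; exact/measurable_EFinP.
  over.
rewrite /= ge0_integralZr//; first last.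
- by apply: integral_ge0.
- by apply/measurable_EFinP; apply: measurableT_comp => //; exact/measurable_EFinP.
have ufin : (\int[m1]_x `|(EFin \o u) x|)%E \is a fin_num.
  by rewrite ge0_fin_numE//; exact: integral_ge0.
by apply: lte_mul_pinfty => //; apply: integral_ge0.
Qed.

Lemma Rintegral_tensor2 (u : T1 -> R) (v : T2 -> R) :
  m1.-integrable setT (EFin \o u) -> m2.-integrable setT (EFin \o v) ->
  Rintegral (m1 \x m2)%E setT (fun z => u z.1 * v z.2) =
  Rintegral m1 setT u * Rintegral m2 setT v.
Proof.
move=> iu iv; have iuv := integrable_tensor2 iu iv.
rewrite /Rintegral -(integral12_prod_meas1 iuv).
have vfin := integrable_fin_num measurableT iv.
have ufin := integrable_fin_num measurableT iu.
rewrite [in LHS](eq_integral (fun x => (u x)%:E * (\int[m2]_y (v y)%:E)))%E; last first.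
  by move=> x _; rewrite -integralZl.
by rewrite -(fineK vfin) integralZr// -(fineK ufin) -EFinM.
Qed.

Lemma cintg_tensor2 (u : T1 -> R[i]) (v : T2 -> R[i]) : cintg m1 u -> cintg m2 v ->
  cintg (m1 \x m2)%E (fun z => u z.1 * v z.2) /\
  cInt (m1 \x m2)%E (fun z => u z.1 * v z.2) = cInt m1 u * cInt m2 v.
Proof.
move=> [ur ui] [vr vi].
have rr := integrable_tensor2 ur vr; have ii := integrable_tensor2 ui vi.
have ri := integrable_tensor2 ur vi; have ir := integrable_tensor2 ui vr.
have reE : (fun z : T1 * T2 => complex.Re (u z.1 * v z.2)) =
    fun z => complex.Re (u z.1) * complex.Re (v z.2) -
             complex.Im (u z.1) * complex.Im (v z.2).
  by apply/funext => z; case: (u _) => ? ?; case: (v _).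
have imE : (fun z : T1 * T2 => complex.Im (u z.1 * v z.2)) =
    fun z => complex.Re (u z.1) * complex.Im (v z.2) +
             complex.Im (u z.1) * complex.Re (v z.2).
  by apply/funext => z; case: (u _) => ? ?; case: (v _).
split; first split.
- rewrite -[X in integrable _ _ X]/(EFin \o
    (fun z : T1 * T2 => complex.Re (u z.1 * v z.2))) reE.
  exact: (integrableB measurableT rr ii).
- rewrite -[X in integrable _ _ X]/(EFin \o
    (fun z : T1 * T2 => complex.Im (u z.1 * v z.2))) imE.
  exact: (integrableD measurableT ri ir).
rewrite /cInt reE imE RintegralB// RintegralD//.
by congr (_ +i* _)%C; [congr (_ - _)|congr (_ + _)]; exact: Rintegral_tensor2.
Qed.

End product_integral.

Section tensor_integral.
Context {R : realType}.
Notation mu n := (lebesgue_Rn R n).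
Notation leb := (@lebesgue_measure R).

Lemma cmeas_tensor n (h : 'I_n -> measurableTypeR R -> R[i]) :
  (forall i, cmeas (h i)) -> cmeas (fun x : Rn R n => \prod_(i < n) h i (tnth x i)).
Proof.
move=> hi; apply: cmeas_prod => i.
by apply: (cmeas_comp (f := h i)) => //; exact: measurable_tnth.
Qed.

(** By construction [lebesgue_Rn] in dimension [n.+1] is the image of a product measure under
    [tcons]. *)
Lemma integral_cons n (f : Rn R n.+1 -> R) : measurable_fun setT f ->
  (leb \x mu n)%E.-integrable setT (fun z => (f (tcons z))%:E) ->
  (mu n.+1).-integrable setT (EFin \o f) /\
  Rintegral (mu n.+1) setT f = Rintegral (leb \x mu n)%E setT (fun z => f (tcons z)).
Proof.
move=> /measurable_EFinP mf fi; have mt := @measurable_tcons _ (measurableTypeR R) n.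
split; first exact: (integrable_pushforward mt mf fi).
by rewrite /Rintegral; congr fine; exact: (integral_pushforward mt mf fi).
Qed.

Lemma integral_Rn0 (f : Rn R 0 -> R) : measurable_fun setT f ->
  (mu 0).-integrable setT (EFin \o f) /\ Rintegral (mu 0) setT f = f [tuple].
Proof.
move=> mf; split.
  apply/integrableP; split; first exact/measurable_EFinP.
  rewrite integral_dirac//; last by apply/measurable_EFinP; exact: measurableT_comp.
  by rewrite diracT mul1e ltry.
by rewrite /Rintegral integral_dirac//; [rewrite diracT mul1e|exact/measurable_EFinP].
Qed.

(** Induction on the dimension, splitting off the first coordinate; in dimension 0 the measure is a
    Dirac mass and the product is empty. *)
Lemma cintg_tensor n (h : 'I_n -> measurableTypeR R -> R[i]) :
  (forall i, cintg leb (h i)) ->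
  cintg (mu n) (fun x : Rn R n => \prod_(i < n) h i (tnth x i)) /\
  cInt (mu n) (fun x : Rn R n => \prod_(i < n) h i (tnth x i)) =
    \prod_(i < n) cInt leb (h i).
Proof.
elim: n h => [|n ih] h hi; have [mr mi] := cmeas_tensor (fun i => cintg_cmeas (hi i)).
  have [ir er] := integral_Rn0 mr; have [ii ei] := integral_Rn0 mi.
  by split; [split|rewrite /cInt er ei !big_ord0].
have [ci cE] := ih _ (fun i => hi (lift ord0 i)).
have := cintg_tensor2 (hi ord0) ci.
have tE : (fun z : measurableTypeR R * Rn R n =>
      h ord0 z.1 * \prod_(i < n) h (lift ord0 i) (tnth z.2 i)) =
    (fun z => \prod_(i < n.+1) h i (tnth (tcons z) i)).
  apply/funext => z /=; rewrite big_ord_recl/=; congr (_ * _).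
  by apply: eq_bigr => i _; rewrite [in RHS](tnth_nth 0)/= -tnth_nth.
rewrite tE => -[[cr ci'] cE2].
have [ir er] := integral_cons mr cr; have [ii ei] := integral_cons mi ci'.
by split; [split|rewrite big_ord_recl -cE -cE2 /cInt er ei].
Qed.

Lemma intg_tensor n (g : 'I_n -> measurableTypeR R -> R) : (forall i, intg (g i)) ->
  (mu n).-integrable setT (fun x : Rn R n => (\prod_(i < n) g i (tnth x i))%:E) /\
  Rintegral (mu n) setT (fun x : Rn R n => \prod_(i < n) g i (tnth x i)) =
    \prod_(i < n) Int (g i).
Proof.
move=> gi; have gci i : cintg leb (fun x => (g i x)%:C%C).
  by split; [exact: gi|exact: integrable0].
have prodC (I : finType) (F : I -> R) : (\prod_i (F i)%:C%C) = (\prod_i F i)%:C%C.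
  by rewrite rmorph_prod.
have [] := cintg_tensor gci; rewrite /cintg /cInt.
under eq_fun do rewrite prodC/=; move=> [h _].
under eq_fun do rewrite prodC/=.
under eq_bigr do rewrite (Rintegral_cst _ measurableT) mul0r.
by rewrite prodC => -[e _]; split.
Qed.

End tensor_integral.

(** * One-dimensional packets with frequencies in arithmetic progression *)

Section complex_exponential.
Context {R : realType}.
Implicit Types (a b : R) (z w : R[i]).
Notation normc := Normc.normc.

Lemma expiD a b : expi (a + b) = expi a * expi b.
Proof. by rewrite /expi cosD sinD [in RHS]/GRing.mul/= [sin a * _ + _]addrC. Qed.

Lemma expi0 : expi 0 = 1 :> R[i].
Proof. by rewrite /expi cos0 sin0. Qed.

Lemma expi_sum (I : Type) (s : seq I) (a : I -> R) :
  expi (\sum_(i <- s) a i) = \prod_(i <- s) expi (a i).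
Proof.
elim: s => [|i s ih]; first by rewrite !big_nil expi0.
by rewrite !big_cons expiD ih.
Qed.

Lemma normc_real (a : R) : normc (a%:C%C) = `|a|.
Proof. by rewrite /= expr0n addr0 sqrtr_sqr. Qed.

Lemma normc_expi a : normc (expi a) = 1.
Proof. by rewrite /= cos2Dsin2 sqrtr1. Qed.

Lemma normc_ge0 z : 0 <= normc z.
Proof. by case: z => u v /=; rewrite sqrtr_ge0. Qed.

Lemma normc_sq z : normc z ^+ 2 = complex.Re z ^+ 2 + complex.Im z ^+ 2.
Proof. by case: z => u v /=; rewrite sqr_sqrtr// addr_ge0 ?sqr_ge0. Qed.

Lemma normc_prod (I : Type) (s : seq I) (z : I -> R[i]) :
  normc (\prod_(i <- s) z i) = \prod_(i <- s) normc (z i).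
Proof.
elim: s => [|i s ih]; first by rewrite !big_nil -[1]/(1%:C%C) normc_real normr1.
by rewrite !big_cons Normc.normcM ih.
Qed.

(** The left side is the real part of [expi (- c)] times the number; the squares of the two sides
    differ by [(u * sin c - v * cos c) ^+ 2]. *)
Lemma re_rotate_le_normc (u v c : R) : u * cos c + v * sin c <= normc (u +i* v)%C.
Proof.
have [h|h] := leP 0 (u * cos c + v * sin c); last first.
  by rewrite (le_trans (ltW h)) ?normc_ge0.
rewrite -(ger0_norm h) -sqrtr_sqr ler_sqrt; last by rewrite addr_ge0 ?sqr_ge0.
rewrite -subr_ge0 (_ : _ - _ = (u * sin c - v * cos c) ^+ 2) ?sqr_ge0//.
have := cos2Dsin2 c; set C := cos c; set S := sin c => e.
rewrite -[u ^+ 2 + _]mulr1 -e; ring.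
Qed.

Lemma normc_sum_le (I : Type) (s : seq I) (z : I -> R[i]) :
  normc (\sum_(i <- s) z i) <= \sum_(i <- s) normc (z i).
Proof.
elim: s => [|i s ih]; first by rewrite !big_nil -[0]/(0%:C%C) normc_real normr0.
by rewrite !big_cons (le_trans (le_normcD _ _))// lerD2l.
Qed.

Lemma Re_sum (I : Type) (s : seq I) (z : I -> R[i]) :
  complex.Re (\sum_(i <- s) z i) = \sum_(i <- s) complex.Re (z i).
Proof.
elim: s => [|i s ih]; rewrite ?big_nil// !big_cons -ih.
by case: (z i) => ? ?; case: (\sum_(_ <- _) _).
Qed.

Lemma Im_sum (I : Type) (s : seq I) (z : I -> R[i]) :
  complex.Im (\sum_(i <- s) z i) = \sum_(i <- s) complex.Im (z i).
Proof.
elim: s => [|i s ih]; rewrite ?big_nil// !big_cons -ih.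
by case: (z i) => ? ?; case: (\sum_(_ <- _) _).
Qed.

Lemma Re_scale (r : R) z : complex.Re (r%:C%C * z) = r * complex.Re z.
Proof. by case: z => u v /=; rewrite mul0r subr0. Qed.

Lemma Im_scale (r : R) z : complex.Im (r%:C%C * z) = r * complex.Im z.
Proof. by case: z => u v /=; rewrite mul0r addr0. Qed.

Lemma normc_sum_expi_sq L (a : 'I_L -> R) :
  normc (\sum_(l < L) expi (a l)) ^+ 2 = \sum_(l < L) \sum_(m < L) cos (a l - a m).
Proof.
rewrite normc_sq Re_sum Im_sum /= !expr2 !mulr_suml -big_split/=.
apply: eq_bigr => l _; rewrite !mulr_sumr -big_split/=.
by apply: eq_bigr => m _; rewrite cosB.
Qed.

Lemma measurable_normc d (T : measurableType d) (f : T -> R[i]) :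
  cmeas f -> measurable_fun setT (fun x => normc (f x)).
Proof.
move=> [fr fi]; rewrite (_ : (fun _ => _) = fun x =>
    Num.sqrt (complex.Re (f x) ^+ 2 + complex.Im (f x) ^+ 2)).
  apply: (@measurableT_comp _ _ _ _ _ _
    (@Num.sqrt R : measurableTypeR R -> measurableTypeR R)).
    by apply: continuous_measurable_fun; exact: sqrt_continuous.
  by apply: measurable_funD; exact: measurable_funX.
by apply/funext => x; case: (f x).
Qed.

End complex_exponential.

Section packet.
Context {R : realType}.
Notation leb := (@lebesgue_measure R).
Notation normc := Normc.normc.
Variables (lam th D : R) (L : nat).
Hypothesis lam_gt0 : 0 < lam.

Definition freq (l : 'I_L) : R := th + D * l%:R.

(** A Fejer kernel of width [1 / lam] carrying [L] frequencies. Up to the factor [fejer_mass] its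
    transform is [comb], a sum of tents of half-width [lam]: nonnegative and of compact support. *)
Definition packet (x : measurableTypeR R) : R[i] :=
  (lam * fejer (lam * x))%:C%C * \sum_(l < L) expi (freq l * x).

Definition comb (xi : measurableTypeR R) : R :=
  \sum_(l < L) tent ((xi - freq l) / lam).

Let lam0 : lam != 0. Proof. by rewrite gt_eqF. Qed.

Lemma packetE xi x : expi (- (x * xi)) * packet x =
  \sum_(l < L) (lam * fejer (lam * x + 0))%:C%C *
    expi ((freq l - xi) / lam * (lam * x + 0)).
Proof.
rewrite addr0 mulrCA mulr_sumr mulr_sumr; apply: eq_bigr => l _; congr (_ * _).
by rewrite -expiD; congr expi; field.
Qed.

Lemma tentN (x : R) : tent (- x) = tent x.
Proof. by rewrite !tentE normrN. Qed.

(** After rescaling by [lam], each frequency contributes a cosine integral, which is a tent, and a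
    sine integral, which vanishes by parity. *)
Lemma packet_fourier xi :
  cintg leb (fun x => expi (- (x * xi)) * packet x) /\
  cInt leb (fun x => expi (- (x * xi)) * packet x) = (fejer_mass * comb xi)%:C%C.
Proof.
pose g l (x : measurableTypeR R) :=
  lam * (fejer (lam * x + 0) * cos ((freq l - xi) / lam * (lam * x + 0))).
pose h l (x : measurableTypeR R) :=
  lam * (fejer (lam * x + 0) * sin ((freq l - xi) / lam * (lam * x + 0))).
have gi l : intg (g l).
  by apply: intgZ; exact: (intg_affine 0 lam0 (intg_fejer_cos _)).
have hi l : intg (h l).
  by apply: intgZ; exact: (intg_affine 0 lam0 (intg_fejer_sin _)).
have reE : (fun x => complex.Re (expi (- (x * xi)) * packet x)) =
    fun x => \sum_(l < L) g l x.
  apply/funext => x; rewrite packetE Re_sum; apply: eq_bigr => l _.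
  by rewrite Re_scale -mulrA.
have imE : (fun x => complex.Im (expi (- (x * xi)) * packet x)) =
    fun x => \sum_(l < L) h l x.
  apply/funext => x; rewrite packetE Im_sum; apply: eq_bigr => l _.
  by rewrite Im_scale -mulrA.
split.
  split.
    rewrite -[X in integrable _ _ X]/(EFin \o
      (fun x => complex.Re (expi (- (x * xi)) * packet x))) reE.
    exact: intg_sum.
  rewrite -[X in integrable _ _ X]/(EFin \o
    (fun x => complex.Im (expi (- (x * xi)) * packet x))) imE.
  exact: intg_sum.
rewrite /cInt reE imE; congr (_ +i* _)%C.
  rewrite -/(Int _) Int_sum// /comb mulr_sumr; apply: eq_bigr => l _.
  rewrite /g IntZ; last exact: (intg_affine 0 lam0 (intg_fejer_cos _)).
  rewrite (Int_affine 0 lam0 (intg_fejer_cos _)) Int_fejer_cos gtr0_norm//.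
  by rewrite mulrA divff// mul1r -tentN; congr (_ * tent _); field.
rewrite -/(Int _) Int_sum// big1// => l _.
rewrite /h IntZ; last exact: (intg_affine 0 lam0 (intg_fejer_sin _)).
by rewrite (Int_affine 0 lam0 (intg_fejer_sin _)) Int_fejer_sin !mulr0.
Qed.

Lemma packet_cmeas : cmeas packet.
Proof.
have [/cintg_cmeas h _] := packet_fourier 0.
by rewrite (_ : packet = fun x => expi (- (x * 0)) * packet x)//;
  apply/funext => x; rewrite mulr0 oppr0 expi0 mul1r.
Qed.

Lemma normc_packet_le x : normc (packet x) <= L%:R * (lam * fejer (lam * x + 0)).
Proof.
rewrite /packet Normc.normcM normc_real ger0_norm; last first.
  by rewrite mulr_ge0 ?fejer_ge0// ltW.
rewrite addr0 [leLHS]mulrC; apply: ler_wpM2r.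
  by apply: mulr_ge0; [exact: ltW|exact: fejer_ge0].
apply: (le_trans (normc_sum_le _ _)).
under eq_bigr do rewrite normc_expi.
by rewrite sumr_const card_ord.
Qed.

Lemma intg_normc_packet : intg (fun x => normc (packet x)).
Proof.
apply: (@le_intg _ _ (fun x => L%:R * (lam * fejer (lam * x + 0)))).
- exact: measurable_normc packet_cmeas.
- by move=> x; rewrite ger0_norm ?normc_ge0// normc_packet_le.
- by do 2 apply: intgZ; exact: (intg_affine 0 lam0 intg_fejer).
Qed.

Lemma packet_sqE x : normc (packet x) ^+ 2 = \sum_(l < L) \sum_(m < L)
  lam ^+ 2 * (fejer (lam * x + 0) ^+ 2 * cos ((D * (l%:R - m%:R)) / lam * (lam * x + 0))).
Proof.
rewrite /packet Normc.normcM normc_real exprMn normc_sum_expi_sq real_normK ?num_real//.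
rewrite mulr_sumr; apply: eq_bigr => l _; rewrite mulr_sumr; apply: eq_bigr => m _.
rewrite addr0 exprMn -mulrA; congr (_ * (_ * cos _)).
by rewrite /freq; field.
Qed.

Lemma intg_packet_sq : intg (fun x => normc (packet x) ^+ 2).
Proof.
under eq_fun do rewrite packet_sqE.
do 2 (apply: intg_sum => ?); apply: intgZ.
exact: (intg_affine 0 lam0 (intg_fejer2_cos _)).
Qed.

(* Distinct frequencies are at distance at least [2 * lam], which makes the
   modulated Fejer kernels orthogonal. *)
Lemma Int_packet_sq : ((L <= 1)%N \/ 2 * lam <= D) ->
  Int (fun x => normc (packet x) ^+ 2) = L%:R * lam * fejer2_mass.
Proof.
move=> LD; under eq_Int do rewrite packet_sqE.
have ai (l m : 'I_L) := intg_affine 0 lam0 (intg_fejer2_cos (D * (l%:R - m%:R) / lam)).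
have zi l m := intgZ (lam ^+ 2) (ai l m).
rewrite Int_sum => [|l]; last by apply: intg_sum => m; exact: zi.
transitivity (\sum_(l < L) lam * fejer2_mass); last first.
  by rewrite sumr_const card_ord -[RHS]mulrA mulr_natl.
apply: eq_bigr => l _; rewrite Int_sum; last by move=> m; exact: zi.
have IE m : Int (fun x => lam ^+ 2 * (fejer (lam * x + 0) ^+ 2 *
    cos (D * (l%:R - m%:R) / lam * (lam * x + 0)))) =
    lam * Int (fun x => fejer x ^+ 2 * cos (D * (l%:R - m%:R) / lam * x)).
  rewrite IntZ; last exact: (intg_affine 0 lam0 (intg_fejer2_cos _)).
  rewrite (Int_affine 0 lam0 (intg_fejer2_cos _)) gtr0_norm//.
  by rewrite mulrA; congr (_ * _); field.
under eq_bigr do rewrite IE.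
(* The diagonal term gives the mass. For [m != l] the modulus of [D * (l - m) / lam] is at least 2,
   where [Int_fejer2_cos] gives 0. *)
rewrite (bigD1 l)//= big1 ?addr0 => [|m ml].
  congr (_ * _); apply: eq_Int => x.
  by rewrite subrr mulr0 !mul0r cos0 mulr1.
(* Two distinct indices exclude [L <= 1]. *)
have {}LD : 2 * lam <= D.
  by case: LD => // L1; case/negP: ml; apply/eqP/val_inj => /=;
    have := leq_trans (ltn_ord m) L1; have := leq_trans (ltn_ord l) L1;
    rewrite !ltnS !leqn0 => /eqP -> /eqP ->.
rewrite Int_fejer2_cos ?mulr0//.
have D0 : 0 < D by rewrite (lt_le_trans _ LD)// mulr_gt0.
rewrite !normrM normfV (gtr0_norm lam_gt0) (gtr0_norm D0) ler_pdivlMr//.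
rewrite (le_trans LD)// ler_peMr ?(ltW D0)//.
rewrite -[X in 1 <= `|X|]/((l : nat)%:R - (m : nat)%:R).
have [lm|lm] := leqP l m.
  rewrite distrC -natrB// normr_nat ler1n subn_gt0 ltn_neqAle lm andbT.
  by rewrite eq_sym.
by rewrite -natrB 1?ltnW// normr_nat ler1n subn_gt0.
Qed.

Lemma comb_ge0 xi : 0 <= comb xi.
Proof. by apply: sumr_ge0 => l _; exact: tent_ge0. Qed.

Lemma comb_le xi : comb xi <= L%:R.
Proof.
apply: le_trans (ler_sum _ (fun l _ => tent_le1 _)) _.
by rewrite sumr_const card_ord.
Qed.

Lemma comb_neq0 xi : comb xi != 0 -> exists l, `|xi - freq l| < lam.
Proof.
move=> h; have [/existsP[l tl]|/existsPn tn] :=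
    boolP [exists l : 'I_L, tent ((xi - freq l) / lam) != 0].
  exists l; have := tent_neq0 tl.
  by rewrite normrM normfV (gtr0_norm lam_gt0) ltr_pdivrMr// mul1r.
by case/eqP: h; rewrite /comb big1// => l _; apply/eqP; rewrite -[_ == _]negbK tn.
Qed.

Lemma tent_affineE l (xi : R) :
  tent ((xi - freq l) / lam) = tent (lam^-1 * xi + - (freq l / lam)).
Proof. by congr tent; field. Qed.

Lemma intg_comb : intg comb.
Proof.
apply: intg_sum => l; under eq_fun do rewrite tent_affineE.
by apply: intg_affine; [rewrite invr_eq0|exact: intg_tent].
Qed.

Lemma Int_comb : Int comb = L%:R * lam * tent_mass.
Proof.
have il l : intg (fun x => tent (lam^-1 * x + - (freq l / lam))).
  by apply: intg_affine; [rewrite invr_eq0|exact: intg_tent].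
rewrite /comb; under eq_Int do under eq_bigr do rewrite tent_affineE.
rewrite Int_sum// (eq_bigr (fun=> lam * tent_mass)) => [|l _].
  by rewrite sumr_const card_ord -[RHS]mulrA mulr_natl.
by rewrite (Int_affine _ _ intg_tent) ?invr_eq0// normfV invrK gtr0_norm.
Qed.

Lemma intg_comb_sq : intg (fun xi => comb xi ^+ 2).
Proof.
apply: (@le_intg _ _ (fun x => L%:R * comb x)).
- by apply: measurable_funX; exact: intg_mfun intg_comb.
- by move=> x; rewrite ger0_norm ?sqr_ge0// expr2 ler_wpM2r ?comb_le ?comb_ge0.
- exact: intgZ intg_comb.
Qed.

End packet.

(** * Lower bound for an oscillatory integral with aligned phases *)

Section aligned_phase.
Context {R : realType}.
Notation normc := Normc.normc.
Notation leb := (@lebesgue_measure R).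
Variables (g : measurableTypeR R -> R) (x t : R).
Hypotheses (gi : intg g) (g0 : forall xi, 0 <= g xi).

Let phase (xi : R) := x * xi + t * xi ^+ 2.

Let cphase : continuous phase.
Proof.
move=> y; apply: continuousD; first exact: mulrl_continuous.
by apply: continuousM; [exact: cst_continuous|exact: exprn_continuous].
Qed.

Let mul_phase_intg (w : R -> R) : continuous w -> (forall y, `|w y| <= 1) ->
  intg (fun xi => w (phase xi) * g xi).
Proof.
move=> cw w1; apply: (@le_intg _ _ g) => //.
  apply: measurable_funM; last exact: intg_mfun.
  apply: continuous_measurable_fun => y.
  by apply: continuous_comp; [exact: cphase|exact: cw].
by move=> xi; rewrite normrM (ger0_norm (g0 _)) ler_piMl.
Qed.

Lemma cintg_evolution : cintg leb (fun xi => expi (x * xi + t * xi ^+ 2) * (g xi)%:C%C).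
Proof.
rewrite /cintg; under eq_fun do rewrite mulrC Re_scale mulrC/=.
under [X in _ /\ integrable _ _ X]eq_fun do rewrite mulrC Im_scale mulrC/=.
split; apply: mul_phase_intg; [exact: continuous_cos|exact: cos_max| |].
- exact: continuous_sin.
- exact: sin_max.
Qed.

(** After rotation by [expi (- c)] the real part of the integrand is at least [g / 2] everywhere, so
    that no cancellation occurs. *)
Lemma evolution_lower_bound (c : R) :
  (forall xi, g xi != 0 -> 2^-1 <= cos (x * xi + t * xi ^+ 2 - c)) ->
  2^-1 * Int g <= normc (cInt leb (fun xi => expi (x * xi + t * xi ^+ 2) * (g xi)%:C%C)).
Proof.
move=> hc; rewrite [X in normc X](_ : _ = (Int (fun xi => cos (x * xi + t * xi ^+ 2) * g xi)
    +i* Int (fun xi => sin (x * xi + t * xi ^+ 2) * g xi))%C); last first.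
  by congr (_ +i* _)%C; apply: eq_Int => xi; rewrite mulrC ?Re_scale ?Im_scale mulrC.
apply: le_trans (re_rotate_le_normc _ _ c).
have ci := mul_phase_intg (@continuous_cos R) (@cos_max R).
have si := mul_phase_intg (@continuous_sin R) (@sin_max R).
rewrite [X in _ <= X + _]mulrC [X in _ <= _ + X]mulrC -!IntZ// -IntD; last 2 first.
- exact: intgZ.
- exact: intgZ.
apply: le_Int; [exact: intgZ|by apply: intgD; exact: intgZ|].
move=> xi; rewrite (mulrA (cos c)) (mulrA (sin c)) -mulrDl.
have [->|/hc h] := eqVneq (g xi) 0; first by rewrite !mulr0.
by rewrite ler_wpM2r//; move: h; rewrite cosB; lra.
Qed.

End aligned_phase.

(** * The tensor test function *)

Section norms.
Context {R : realType} {n : nat}.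
Notation mu := (lebesgue_Rn R n).
Notation normc := Normc.normc.
Implicit Types f g : Rn R n -> R[i].

(* Unlike [ge0_le_integral], without measurability, so that it applies to the
   maximal function. *)
Lemma ge0_le_integralT d (T : measurableType d) (m : {measure set T -> \bar R})
    (u v : T -> \bar R) : (forall x, 0 <= u x)%E -> (forall x, u x <= v x)%E ->
  (\int[m]_x u x <= \int[m]_x v x)%E.
Proof.
move=> u0 uv; have v0 x : (0 <= v x)%E by exact: le_trans (u0 x) (uv x).
rewrite !ge0_integralTE//; apply: ereal_sup_le => _ [h hu <-].
by exists h => // x; exact: le_trans (hu x) (uv x).
Qed.

Lemma cLnorm2E f : mu.-integrable setT (fun x => (normc (f x) ^+ 2)%:E) ->
  cLnorm 2%:E f = (Num.sqrt (Rintegral mu setT (fun x => normc (f x) ^+ 2)))%:E.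
Proof.
move=> fi; rewrite /cLnorm unlock.
under eq_integral => x _.
  rewrite abse_EFin poweR_EFin ger0_norm ?normc_ge0// powR_mulrn ?normc_ge0//.
  over.
have ffin := integrable_fin_num measurableT fi.
rewrite /= -(fineK ffin) poweR_EFin powR12_sqrt//.
by apply: Rintegral_ge0 => x _; rewrite sqr_ge0.
Qed.

Lemma cLnorm_eq0 (p : R) f : p != 0 -> f =1 (fun=> 0) -> cLnorm p%:E f = 0%E.
Proof.
move=> p0 f0; rewrite /cLnorm -(@Lnorm0 _ _ _ mu p%:E)//.
by apply: eq_Lnorm => x; rewrite f0 Normc.normc0.
Qed.

Lemma in_L1 f : cmeasurable f -> mu.-integrable setT (fun x => (normc (f x))%:E) ->
  in_Lp 1%:E f.
Proof.
move=> mf fi; split => //; rewrite /cLnorm Lnorm1.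
by apply: integrable_lty => //; exact: integrable_abse.
Qed.

Lemma in_L2 f : cmeasurable f -> mu.-integrable setT (fun x => (normc (f x) ^+ 2)%:E) ->
  in_Lp 2%:E f.
Proof. by move=> mf fi; split => //; rewrite cLnorm2E// ltry. Qed.

(** A function that is already in both spaces is approximated by the constant sequence, with error
    0. *)
Lemma is_fourier_L1 f g : cmeasurable f -> cmeasurable g ->
  mu.-integrable setT (fun x => (normc (f x))%:E) ->
  mu.-integrable setT (fun x => (normc (f x) ^+ 2)%:E) ->
  mu.-integrable setT (fun x => (normc (g x) ^+ 2)%:E) ->
  fourierL1 f =1 g -> is_fourier f g.
Proof.
move=> mf mg f1 f2 g2 fg.
have two0 : 2 != 0 :> R by [].
split; [exact: in_L2|exact: in_L2|exists (fun=> f); split].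
- by move=> _; split; [exact: in_L1|exact: in_L2].
- rewrite cLnorm_eq0//; first exact: cvg_cst.
  by move=> x; rewrite subrr.
- rewrite cLnorm_eq0//; first exact: cvg_cst.
  by move=> x; rewrite fg subrr.
Qed.

Lemma coord_le_edist (x y : n.-tuple R) (i : 'I_n) : `|tnth x i - tnth y i| <= edist x y.
Proof.
rewrite -sqrtr_sqr ler_sqrt; last by apply: sumr_ge0 => j _; exact: sqr_ge0.
by rewrite (bigD1 i)//= lerDl sumr_ge0// => j _; exact: sqr_ge0.
Qed.

Lemma edist_lt (x y : n.-tuple R) (r : R) : (0 < n)%N -> 0 < r ->
  (forall i, `|tnth x i - tnth y i| < r / n%:R) -> edist x y < r.
Proof.
move=> n0 r0 h; have nR : 0 < n%:R :> R by rewrite ltr0n.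
rewrite -[ltRHS](gtr0_norm r0) -sqrtr_sqr ltr_sqrt ?exprn_gt0//.
apply: (@lt_le_trans _ _ (\sum_(i < n) (r / n%:R) ^+ 2)).
  have h2 (i : 'I_n) : (tnth x i - tnth y i) ^+ 2 < (r / n%:R) ^+ 2.
    by rewrite -(real_normK (num_real _)) ltrXn2r// ?nnegrE ?divr_ge0 ?ltW// h.
  (* The strict inequality between the sums is drawn from the first coordinate, which exists because
     the dimension is positive. *)
  case: (n) x y h n0 nR h2 => // m x y h _ mR h2.
  rewrite !big_ord_recl ltr_leD//; apply: ler_sum => i _; exact/ltW.
rewrite sumr_const card_ord -[leLHS]mulr_natl.
rewrite (_ : n%:R * (r / n%:R) ^+ 2 = r ^+ 2 / n%:R); last first.
  by field; rewrite gt_eqF.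
by rewrite ler_pdivrMr// ler_peMr ?sqr_ge0// ler1n.
Qed.

Lemma cIntZ (k : R) f : cintg mu f ->
  cInt mu (fun x => k%:C%C * f x) = k%:C%C * cInt mu f.
Proof.
move=> [fr fi]; rewrite /cInt; under eq_fun do rewrite Re_scale.
under [X in (_ +i* Rintegral _ _ X)%C]eq_fun do rewrite Im_scale.
by rewrite !RintegralZl// /GRing.mul/= !mul0r subr0 addr0.
Qed.

End norms.

(** * The test function, its norm, its support and its evolution *)

Section tensor_packet.
Context {R : realType} {n : nat}.
Notation mu := (lebesgue_Rn R n).
Notation normc := Normc.normc.
Variables (lam th : 'I_n -> R) (D : R) (L : 'I_n -> nat).
Hypothesis n_gt0 : (0 < n)%N.
Hypothesis lam_gt0 : forall i, 0 < lam i.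

Definition tpacket (x : Rn R n) : R[i] :=
  \prod_(i < n) packet (lam i) (th i) D (L i) (tnth x i).

Definition fourier_real : R := (2 * pi) `^ (- (n%:R / 2)).

Definition tcomb_cst : R := fourier_real * fejer_mass ^+ n.

Definition tcomb (xi : Rn R n) : R[i] :=
  (tcomb_cst * \prod_(i < n) comb (lam i) (th i) D (L i) (tnth xi i))%:C%C.

Lemma fourier_real_gt0 : 0 < fourier_real.
Proof. by rewrite powR_gt0// mulr_gt0// pi_gt0. Qed.

Lemma tcomb_cst_gt0 : 0 < tcomb_cst.
Proof. by rewrite mulr_gt0 ?fourier_real_gt0 ?exprn_gt0 ?fejer_mass_gt0. Qed.

Lemma fourierL1_tpacket : fourierL1 tpacket =1 tcomb.
Proof.
move=> xi; rewrite /fourierL1.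
have h i := packet_fourier (th i) D (L i) (lam_gt0 i) (tnth xi i).
have [_ e] := cintg_tensor (fun i => (h i).1).
rewrite [cintegral _](_ : _ =
  \prod_(i < n) (fejer_mass * comb (lam i) (th i) D (L i) (tnth xi i))%:C%C).
  rewrite -rmorph_prod -rmorphM /tcomb/=; congr (_%:C)%C.
  by rewrite big_split/= prodr_const card_ord mulrA.
rewrite (eq_bigr _ (fun i _ => esym (h i).2)) -e.
rewrite -[LHS]/(cInt mu _); congr cInt; apply/funext => x.
rewrite /dot -sumrN expi_sum -big_split/=.
by apply: eq_bigr => i _; congr (expi (- _) * _).
Qed.

Lemma tpacket_cmeas : cmeasurable tpacket.
Proof.
by apply: (@cmeas_tensor R n (fun i => packet (lam i) (th i) D (L i))) => i;
  exact: packet_cmeas.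
Qed.

Lemma tcomb_cmeas : cmeasurable tcomb.
Proof.
split; last exact: measurable_cst.
apply: measurable_funM => //.
have [] := intg_tensor (fun i => intg_comb (th i) D (L i) (lam_gt0 i)).
by move=> /integrableP[/measurable_EFinP].
Qed.

Lemma integrable_tpacket_sq : mu.-integrable setT (fun x => (normc (tpacket x) ^+ 2)%:E) /\
  Rintegral mu setT (fun x => normc (tpacket x) ^+ 2) =
  \prod_(i < n) Int (fun x => normc (packet (lam i) (th i) D (L i) x) ^+ 2).
Proof.
have := intg_tensor (fun i => intg_packet_sq (th i) D (L i) (lam_gt0 i)).
rewrite (_ : (fun x : Rn R n => \prod_(i < n) _) = fun x => normc (tpacket x) ^+ 2).
  rewrite (_ : (fun x : Rn R n => (\prod_(i < n) _)%:E) =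
    fun x => (normc (tpacket x) ^+ 2)%:E)//.
  by apply/funext => x; rewrite /tpacket normc_prod prodrXl.
by apply/funext => x; rewrite /tpacket normc_prod prodrXl.
Qed.

Lemma is_fourier_tpacket : is_fourier tpacket tcomb.
Proof.
apply: is_fourier_L1; [exact: tpacket_cmeas|exact: tcomb_cmeas| |
  exact: integrable_tpacket_sq.1| |exact: fourierL1_tpacket].
- have [] := intg_tensor (fun i => intg_normc_packet (th i) D (L i) (lam_gt0 i)).
  by under eq_fun do rewrite -normc_prod.
- have [] := intg_tensor (fun i => intg_comb_sq (th i) D (L i) (lam_gt0 i)).
  move=> /(integrableZl measurableT (tcomb_cst ^+ 2)) h _; move: h.
  congr (integrable _ _ _); apply/funext => x.
  by rewrite /tcomb normc_real real_normK ?num_real// [in RHS]exprMn -EFinM prodrXl.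
Qed.

Lemma cLnorm_tpacket : (forall i, (L i <= 1)%N \/ 2 * lam i <= D) ->
  cLnorm 2%:E tpacket =
  (Num.sqrt (\prod_(i < n) ((L i)%:R * lam i * fejer2_mass)))%:E.
Proof.
move=> LD; rewrite cLnorm2E; last exact: integrable_tpacket_sq.1.
rewrite integrable_tpacket_sq.2; congr (Num.sqrt _)%:E.
by apply: eq_bigr => i _; exact: Int_packet_sq.
Qed.

(** If a coordinate of [xi] has modulus at least [1 / n], then [tcomb] vanishes on the ball of
    radius [1 / (2 * n)] about [xi], since every tent lies within [1 / (2 * n)] of 0. *)
Lemma ess_supp_tcomb :
  (forall i (l : 'I_(L i)), `|freq (th i) D l| + lam i <= (2 * n%:R)^-1) ->
  ess_supp tcomb `<=` eball origin 1.
Proof.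
move=> hf xi /= hxi; rewrite /eball/=; apply: edist_lt => // i.
rewrite [tnth origin i]tnth_mktuple subr0 div1r ltNge; apply/negP => xi_big.
have nR : 0 < n%:R :> R by rewrite ltr0n.
have e0 : 0 < (2 * n%:R)^-1 :> R by rewrite invr_gt0 mulr_gt0.
have := hxi _ e0; rewrite [X in mu X](_ : _ = set0) ?measure0 ?ltxx//.
apply/seteqP; split => // eta [/= d]; apply/negP; rewrite negbK.
rewrite /tcomb (bigD1 i)//= [comb _ _ _ _ _](_ : _ = 0) ?mul0r ?mulr0//.
apply/eqP; apply: contraT => /(comb_neq0 (lam_gt0 i))[l hl].
have := coord_le_edist eta xi i; have := hf i l; rewrite distrC.
have en : (n%:R)^-1 = (2 * n%:R)^-1 + (2 * n%:R)^-1 :> R by field; rewrite gt_eqF.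
have : `|tnth xi i| <= `|tnth xi i - tnth eta i| + `|tnth eta i - freq (th i) D l| +
    `|freq (th i) D l|.
  rewrite [X in `|X| <= _](_ : _ = (tnth xi i - tnth eta i) +
    (tnth eta i - freq (th i) D l) + freq (th i) D l); last by ring.
  by apply: le_trans (ler_normD _ _) _; rewrite lerD2r ler_normD.
have {}d : edist eta xi < (2 * n%:R)^-1 := d.
move=> h1 h2 h3; move: xi_big; rewrite en leNgt => /negP[].
apply: le_lt_trans h1 _; rewrite -addrA ltr_leD ?(le_lt_trans h3)//.
by rewrite addrC (le_trans _ h2)// lerD2l ltW.
Qed.

(** On the support of the comb the phase stays, modulo [2 * pi], within [pi / 3] of a constant that
    may depend on the coordinate. *)
Definition aligned (x t : R) (i : 'I_n) := exists c : R, forall (l : 'I_(L i)) xi,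
  `|xi - freq (th i) D l| < lam i -> 2^-1 <= cos (x * xi + t * xi ^+ 2 - c).

(** The solution factors over the coordinates, and [evolution_lower_bound] applies to each
    factor. *)
Lemma schrodinger_lower_bound (x : Rn R n) (t : R) :
  (forall i, aligned (tnth x i) t i) ->
  fourier_real * (tcomb_cst * \prod_(i < n) (2^-1 * ((L i)%:R * lam i * tent_mass))) <=
  normc (schrodinger tcomb t x).
Proof.
move=> al; pose g i := comb (lam i) (th i) D (L i).
have gi i : intg (g i) by exact: intg_comb.
have g0 i xi : 0 <= g i xi by exact: comb_ge0.
have [ci e] := cintg_tensor (fun i => cintg_evolution (tnth x i) t (gi i) (g0 i)).
rewrite /schrodinger Normc.normcM normc_real ger0_norm ?powR_ge0//.
rewrite ler_pM2l ?fourier_real_gt0//.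
rewrite [cintegral _](_ : _ = tcomb_cst%:C%C * cInt mu (fun xi : Rn R n => \prod_(i < n)
    (expi (tnth x i * tnth xi i + t * tnth xi i ^+ 2) * (g i (tnth xi i))%:C%C))); last first.
  rewrite -cIntZ//; congr cInt; apply/funext => xi.
  rewrite /tcomb rmorphM/= mulrCA; congr (_ * _).
  rewrite rmorph_prod/= /dot mulr_sumr -big_split/= expi_sum -big_split/=.
  by apply: eq_bigr => i _; congr (expi (_ + _) * _).
rewrite e Normc.normcM normc_real gtr0_norm ?tcomb_cst_gt0// normc_prod.
rewrite ler_pM2l ?tcomb_cst_gt0//; apply: ler_prod => i _.
rewrite mulr_ge0 ?invr_ge0//=; last first.
  by rewrite !mulr_ge0 ?ler0n ?(ltW (lam_gt0 i)) ?(ltW tent_mass_gt0).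
have [c hc] := al i; rewrite -(Int_comb (th i) D (L i) (lam_gt0 i)).
apply: (evolution_lower_bound (gi i) (g0 i) (c := c)) => xi.
by move=> /(comb_neq0 (lam_gt0 i))[l hl]; exact: hc hl.
Qed.

(** The maximal function is at least [A] on a box inside the ball, so its norm is at least [A] times
    the volume of the box to the power [1 / p]. *)
Lemma maximal_estimate_test (p gamma eps C r A : R) (a b : 'I_n -> R) :
  0 < p -> 0 < A -> (forall i, a i <= b i) ->
  ('N[mu]_(p%:E) [schrodinger_max tcomb r \_ (eball origin r)]
         <= (C * r `^ eps * r `^ gamma)%:E * cLnorm 2%:E tpacket)%E ->
  (forall i, (L i <= 1)%N \/ 2 * lam i <= D) ->
  (forall x : Rn R n, (forall i, a i < tnth x i <= b i) ->
    eball origin r x /\ exists2 t, 0 < t <= r & A <= normc (schrodinger tcomb t x)) ->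
  A * (\prod_(i < n) (b i - a i)) `^ p^-1 <=
  C * r `^ eps * r `^ gamma * Num.sqrt (\prod_(i < n) ((L i)%:R * lam i * fejer2_mass)).
Proof.
move=> p0 A0 ab est LD box; move: est; rewrite cLnorm_tpacket// -EFinM unlock => est.
rewrite -lee_fin; apply: le_trans est.
pose ind i := (\1_(`]a i, b i]%classic) : measurableTypeR R -> R).
have [indi indE] := intg_tensor (fun i => intg_itvoc (a i) (b i) : intg (ind i)).
have vol0 : 0 <= \prod_(i < n) (b i - a i).
  by apply: prodr_ge0 => i _; rewrite subr_ge0.
(* The left side is the norm of [A] times the indicator of the box, a tensor product of interval
   indicators; it then suffices to compare integrands. *)
have -> : (A * (\prod_(i < n) (b i - a i)) `^ p^-1)%:E =
    ((\int[mu]_x ((A `^ p)%:E * (\prod_(i < n) ind i (tnth x i))%:E)) `^ p^-1)%E.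
  rewrite integralZl// -(fineK (integrable_fin_num measurableT indi)).
  rewrite -[fine _]/(Rintegral mu setT (fun x : Rn R n => \prod_(i < n) ind i (tnth x i))).
  rewrite indE (eq_bigr _ (fun i _ => Int_itvoc (ab i))) -EFinM poweR_EFin.
  by rewrite powRM ?powR_ge0// -powRrM divff ?gt_eqF// powRr1 ?ltW.
apply: gt0_ler_poweR.
- by rewrite invr_ge0 ltW.
- rewrite in_itv/= leey andbT integral_ge0// => x _; rewrite -EFinM lee_fin.
  by rewrite mulr_ge0 ?powR_ge0// prodr_ge0// => i _; rewrite indicE.
- by rewrite in_itv/= leey andbT integral_ge0// => x _; rewrite poweR_ge0.
apply: ge0_le_integralT => x.
  by rewrite -EFinM lee_fin mulr_ge0 ?powR_ge0// prodr_ge0// => i _; rewrite indicE.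
have [/forallP inbox|/forallPn[i ni]] :=
    boolP [forall i, tnth x i \in `]a i, b i]%classic]; last first.
  by rewrite (bigD1 i)//= {1}/ind indicE (negbTE ni) mul0r mule0 poweR_ge0.
rewrite big1 ?mule1 => [|i _]; last by rewrite /ind indicE inbox.
have [xr [t t0r At]] : eball origin r x /\
    exists2 t, 0 < t <= r & A <= normc (schrodinger tcomb t x).
  by apply: box => i; have := inbox i; rewrite inE/= in_itv/=.
rewrite patchE mem_set// -poweR_EFin; apply: gt0_ler_poweR; rewrite ?(ltW p0)//.
- by rewrite in_itv/= leey andbT lee_fin ltW.
- by rewrite in_itv/= leey andbT abse_ge0.
apply: le_trans (_ : _ <= (normc (schrodinger tcomb t x))%:E)%E _; first by rewrite lee_fin.
apply: le_trans (lee_abs _); apply: ereal_sup_ubound; exists t => //=; rewrite ?in_itv.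
Qed.

End tensor_packet.

(** * Alignment of the phases *)

Section digits.
Context {R : realType}.

(** Let [u] be the integer part of [w * B]. The digit [i] completes [u] to a multiple of [B], and
    the error left is the fractional part of [w * B] divided by [B]. *)
Lemma digit_step (B : nat) (w : R) : (0 < B)%N -> 0 <= w ->
  exists2 i, (i < B)%N & exists z : nat, `|w + i%:R / B%:R - z%:R| <= B%:R^-1.
Proof.
move=> B0 w0; have BR : 0 < B%:R :> R by rewrite ltr0n.
pose u := Num.truncn (w * B%:R).
have /andP[u1 u2] : u%:R <= w * B%:R < u.+1%:R by apply: truncn_itv; rewrite mulr_ge0.
have uE := divn_eq u B.
have {}uE : u%:R = (u %/ B)%:R * B%:R + (u %% B)%:R :> R by rewrite {1}uE natrD natrM.
have close (z i : R) : i + u%:R = z * B%:R -> `|w + i / B%:R - z| <= B%:R^-1.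
  move=> e; have -> : w + i / B%:R - z = (w * B%:R - u%:R) / B%:R.
    by rewrite -(addKr i u%:R) e; field; rewrite gt_eqF.
  rewrite ger0_norm; last by rewrite divr_ge0 ?subr_ge0// ltW.
  rewrite ler_pdivrMr// mulVf ?gt_eqF//.
  by move: u2; rewrite -natr1; lra.
(* With remainder 0 the complement would be [B], which is not a digit; 0 serves instead. *)
have [r0|r0] := eqVneq (u %% B)%N 0%N.
  exists 0%N => //; exists (u %/ B)%N; apply: close.
  by rewrite uE r0 addr0 add0r.
have rB := ltn_pmod u B0.
exists (B - u %% B)%N; first by rewrite ltn_subrL lt0n r0.
exists (u %/ B).+1; apply: close.
by rewrite uE natrB 1?ltnW// -natr1; ring.
Qed.

(* [k] is found digit by digit in base [B]: adding [i * B ^ N] to [k] only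
   changes [k / B ^ j.+1] modulo 1 for [j >= N]. *)
Lemma digits_approx (B N k0 : nat) (y : nat -> R) : (0 < B)%N ->
  (forall j, 0 <= y j) ->
  exists2 k, (k0 <= k < k0 + B ^ N)%N &
    forall j, (j < N)%N ->
      exists z : nat, `|y j + k%:R / B%:R ^+ j.+1 - z%:R| <= B%:R^-1.
Proof.
move=> B0 y0; have BR : B%:R != 0 :> R by rewrite pnatr_eq0 -lt0n.
elim: N => [|N [k /andP[k0k kB] hk]].
  by exists k0 => //; rewrite leqnn expn0 addn1 ltnSn.
have w0 : 0 <= y N + k%:R / B%:R ^+ N.+1 by rewrite addr_ge0 ?divr_ge0 ?exprn_ge0.
have [i iB [z hz]] := digit_step B0 w0.
exists (k + i * B ^ N)%N.
  apply/andP; split; first by rewrite (leq_trans k0k)// leq_addr.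
  apply: (@leq_trans (k0 + B ^ N + i * B ^ N)); first by rewrite ltn_add2r.
  by rewrite -addnA leq_add2l -mulSn expnS leq_mul2r iB orbT.
move=> j; rewrite ltnS leq_eqVlt => /predU1P[->|jN].
  exists z; move: hz; congr (`|_ - _| <= _).
  rewrite natrD natrM natrX -addrA; congr (_ + _); rewrite exprS.
  by field; rewrite BR expf_neq0.
have BN : B%:R ^+ N = B%:R ^+ (N - j.+1) * B%:R ^+ j.+1 :> R by rewrite -exprD subnK.
have [z' hz'] := hk _ jN; exists (z' + i * B ^ (N - j.+1))%N; move: hz'.
congr (`|_| <= _); rewrite !natrD !natrM !natrX BN.
by field; rewrite expf_neq0.
Qed.

End digits.

Section phases.
Context {R : realType}.
Implicit Types x t th D lam eta : R.

Lemma pi_le4 : pi <= 4 :> R.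
Proof. by have [/andP[_]] := pihalf_02_cos_pihalf R; rewrite ler_pdivrMr// -natrM. Qed.

Lemma cos_ge_half (s : R) : `|s| <= 1 -> 2^-1 <= cos s.
Proof.
move=> s1; have := one_sub_cos_le s.
have : s ^+ 2 <= 1 by rewrite -(real_normK (num_real s)) expr_le1.
lra.
Qed.

Lemma cos_2pi_nat (s : R) (m : nat) : cos (s + 2 * pi * m%:R) = cos s.
Proof.
rewrite (_ : 2 * pi * m%:R = (pi *+ 2) *+ m) ?(periodicn (@cosD2pi R))//.
by rewrite -[RHS]mulr_natr -[pi *+ 2]mulr_natl.
Qed.

(** Taylor expansion of the phase at [th]: [x + 2 * t * th] is the displacement from the center of
    the packet. The linear and quadratic terms are each at most [1 / 2]. *)
Lemma single_frequency_phase x t th lam xi : 0 <= t ->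
  `|x + 2 * t * th| * lam <= 2^-1 -> t * lam ^+ 2 <= 2^-1 ->
  `|xi - th| < lam ->
  2^-1 <= cos (x * xi + t * xi ^+ 2 - (x * th + t * th ^+ 2)).
Proof.
move=> t0 h1 h2 hxi; apply: cos_ge_half.
rewrite (_ : _ - _ = (x + 2 * t * th) * (xi - th) + t * (xi - th) ^+ 2); last by ring.
apply: (le_trans (ler_normD _ _)); apply: (@le_trans _ _ (2^-1 + 2^-1)); last by lra.
apply: lerD.
  by apply: le_trans h1; rewrite normrM; apply: ler_wpM2l => //; exact: ltW.
apply: le_trans h2; rewrite normrM (ger0_norm t0); apply: ler_wpM2l => //; rewrite normrX.
by rewrite lerXn2r ?nnegrE ?(le_trans _ (ltW hxi))// ltW.
Qed.

(* With [D ^ 2 * t = 2 * pi * k] and [2 * th = D / q], the phase at the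
   frequency [th + D * l] is congruent to
   [2 * pi * l * (x * D / (2 * pi) + k / q)] modulo [2 * pi]. *)
Lemma lattice_phase x t th D lam (q e xi : R) (k l z : nat) :
  0 <= t -> 0 < D -> t * D ^+ 2 = 2 * pi * k%:R -> 2 * th * q = D -> q != 0 ->
  x * D / (2 * pi) + k%:R / q - z%:R = e ->
  2 * pi * l%:R * `|e| <= 4^-1 ->
  `|x + 2 * t * (th + D * l%:R)| * lam <= 2^-1 -> t * lam ^+ 2 <= 4^-1 ->
  `|xi - (th + D * l%:R)| < lam ->
  2^-1 <= cos (x * xi + t * xi ^+ 2 - (x * th + t * th ^+ 2)).
Proof.
move=> t0 D0 tD thq q0 eE h1 h2 h3 hxi.
have pi0 : 0 < pi :> R by exact: pi_gt0.
set eta := xi - (th + D * l%:R).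
have xiE : xi = th + D * l%:R + eta by rewrite /eta; ring.
have key : x * D + 2 * t * th * D = 2 * pi * (z%:R + e).
  have -> : 2 * t * th * D = t * D ^+ 2 / q.
    by rewrite -thq; field.
  rewrite tD -eE; move: (pi : R) (gt_eqF pi0) => P /negbT P0.
  by field; rewrite q0 P0.
pose s := 2 * pi * l%:R * e + ((x + 2 * t * (th + D * l%:R)) * eta + t * eta ^+ 2).
(* The multiple [l * z] comes from the term linear in [l] by [key], and [k * l ^ 2] from
   [t * D ^+ 2 * l ^+ 2]. Periodicity leaves [s], whose three terms are bounded by [1 / 4], [1 / 2]
   and [1 / 4]. *)
rewrite (_ : _ - _ = s + 2 * pi * (l * z + k * l ^ 2)%:R); last first.
  have -> : x * xi + t * xi ^+ 2 - (x * th + t * th ^+ 2) =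
      l%:R * (x * D + 2 * t * th * D) + t * D ^+ 2 * l%:R ^+ 2 +
      ((x + 2 * t * (th + D * l%:R)) * eta + t * eta ^+ 2).
    by rewrite xiE; ring.
  by rewrite key tD /s natrD !natrM; ring.
rewrite cos_2pi_nat; apply: cos_ge_half; rewrite /s.
have n1 : `|2 * pi * l%:R * e| <= 4^-1.
  by rewrite normrM ger0_norm// !mulr_ge0 ?ler0n ?ltW.
have n2 : `|(x + 2 * t * (th + D * l%:R)) * eta| <= 2^-1.
  by apply: le_trans h2; rewrite normrM; apply: ler_wpM2l => //; exact: ltW.
have n3 : `|t * eta ^+ 2| <= 4^-1.
  apply: le_trans h3; rewrite normrM (ger0_norm t0); apply: ler_wpM2l => //; rewrite normrX.
  by rewrite lerXn2r ?nnegrE ?(le_trans _ (ltW hxi))// ltW.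
apply: (le_trans (ler_normD _ _)).
have := ler_normD ((x + 2 * t * (th + D * l%:R)) * eta) (t * eta ^+ 2).
move: n1 n2 n3; lra.
Qed.

End phases.

Lemma prod_if_lt (R : comRingType) (n N : nat) (a b : R) : (N <= n)%N ->
  \prod_(i < n) (if (i < N)%N then a else b) = a ^+ N * b ^+ (n - N).
Proof.
move=> Nn; rewrite -(big_mkord xpredT (fun i => if (i < N)%N then a else b)).
rewrite (big_cat_nat (leq0n N) Nn)/= (eq_big_nat _ _ (F2 := fun=> a)); last first.
  by move=> i /andP[_ ->].
rewrite [X in _ * X](eq_big_nat _ _ (F2 := fun=> b)); last first.
  by move=> i /andP[]; rewrite leqNgt => /negbTE ->.
by rewrite !big_const_nat subn0 !iter_mulr_1.
Qed.

(** * Choice of the parameters and exponents *)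

(** Used with [P = pi], [a = n], [m = M] and [q = 32 ^+ N]: the number of available times multiplied
    by the time step. *)
Lemma window_identity (R : comRingType) (N : nat) (P a m q : R) :
  q * m ^+ N * (2 * P * (8 * a * m) ^+ 2) = P * (128 * (a ^+ 2 * q) * m ^+ N.+2).
Proof. by rewrite !exprS; ring. Qed.

Section example.
Context {R : realType}.
Variables (n N M : nat).
Hypothesis Nn : (N < n)%N.
Hypothesis M_big : (1024 * n ^ 2 * 32 ^ N <= M)%N.

Let nR : R := n%:R.
Let MR : R := M%:R.
Let QR : R := 32 ^+ N.
(* The first [N] coordinates carry a lattice of frequencies, coordinate [N] the
   moving packet, the others a resting packet; [ex_X ^+ 2] is the radius [R]. *)
Definition ex_c1 : R := (512 * n%:R * 32 ^+ N)^-1.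
Definition ex_c2 : R := (16 * n%:R)^-1.
Definition ex_X : R := M%:R ^+ N.+2.
Definition ex_D : R := (8 * n%:R * M%:R)^-1.
Definition ex_lam (i : 'I_n) : R := if (i < N)%N then ex_c2 / ex_X ^+ 2 else ex_c1 / ex_X.
(** In a lattice coordinate [2 * th * q = ex_D] with [q = (32 * M) ^+ i.+1], as [lattice_phase]
    requires. The packet in coordinate [N] is centered at [t / (2 * n)] at time [t]. *)
Definition ex_th (i : 'I_n) : R :=
  if (i < N)%N then ex_D / (2 * (32 * M)%:R ^+ i.+1)
  else if (i : nat) == N then - (4 * n%:R)^-1 else 0.
Definition ex_L (i : 'I_n) : nat := if (i < N)%N then M else 1.
(** Sides of the box. A resting packet is large only over its width [ex_X]; in the other directions
    the box is comparable to the radius. *)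
Definition ex_b (i : 'I_n) : R := if (i < N.+1)%N then ex_X ^+ 2 / (8 * n%:R) else ex_X.

Let n_gt0 : (0 < n)%N. Proof. exact: leq_ltn_trans Nn. Qed.

Let nR1 : 1 <= nR. Proof. by rewrite ler1n. Qed.

Let QR1 : 1 <= QR. Proof. by rewrite exprn_ege1// ler1n. Qed.

Let M_ge : 1024 * nR ^+ 2 * QR <= MR.
Proof. by move: M_big; rewrite -(ler_nat R) !natrM !natrX. Qed.

Let nQ1 : 1 <= nR ^+ 2 * QR.
Proof. by rewrite mulr_ege1// exprn_ege1. Qed.

Let M1 : 1 <= MR.
Proof. by move: M_ge nQ1; rewrite -mulrA; lra. Qed.

Let M0 : 0 < MR. Proof. exact: lt_le_trans M1. Qed.
Let n0 : 0 < nR. Proof. exact: lt_le_trans nR1. Qed.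
Let Q0 : 0 < QR. Proof. exact: lt_le_trans QR1. Qed.

Let d4 : 0 < 4 * nR. Proof. by rewrite mulr_gt0. Qed.
Let d8 : 0 < 8 * nR. Proof. by rewrite mulr_gt0. Qed.
Let d16 : 0 < 16 * nR. Proof. by rewrite mulr_gt0. Qed.
Let d8M : 0 < 8 * nR * MR. Proof. by rewrite mulr_gt0. Qed.
Let d512 : 0 < 512 * nR * QR. Proof. exact: (mulr_gt0 (mulr_gt0 (ltr0Sn _ _) n0) Q0). Qed.

Let MX : MR <= ex_X.
Proof. by rewrite -[leLHS]expr1; apply: ler_weXn2l. Qed.

Let X1 : 1 <= ex_X. Proof. exact: le_trans MX. Qed.
Let X0 : 0 < ex_X. Proof. exact: lt_le_trans X1. Qed.
Let c10 : 0 < ex_c1. Proof. by rewrite invr_gt0. Qed.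
Let c20 : 0 < ex_c2. Proof. by rewrite invr_gt0. Qed.
Let D0 : 0 < ex_D. Proof. by rewrite invr_gt0. Qed.

Let c1E : ex_c1 * (512 * nR * QR) = 1.
Proof. exact/mulVf/lt0r_neq0/d512. Qed.

Let c1_small : ex_c1 <= (4 * nR)^-1.
Proof.
rewrite lef_pV2 ?posrE ?d4 ?d512//.
have : nR <= nR * QR by rewrite ler_peMr// ltW.
rewrite -/nR -/QR -mulrA; move: n0; lra.
Qed.

Let c1_le : ex_c1 <= 4^-1.
Proof.
apply: le_trans c1_small _; rewrite lef_pV2 ?posrE ?d4//; move: nR1; lra.
Qed.

Let c2_le : ex_c2 <= 16^-1.
Proof. rewrite lef_pV2 ?posrE ?d16//; move: nR1; rewrite /nR; lra. Qed.

Let DM : ex_D * MR = (8 * nR)^-1.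
Proof. by rewrite /ex_D -/nR -/MR; field; rewrite !gt_eqF. Qed.

Lemma ex_lam_gt0 i : 0 < ex_lam i.
Proof. by rewrite /ex_lam; case: ifP => _; rewrite divr_gt0// exprn_gt0. Qed.

Let th_lattice (i : 'I_n) : (i < N)%N -> 0 <= ex_th i <= ex_D.
Proof.
move=> iN; rewrite /ex_th iN.
have q1 : 1 <= (32 * M)%:R ^+ i.+1 :> R.
  by rewrite exprn_ege1// natrM -/MR; move: M1; lra.
rewrite divr_ge0 ?mulr_ge0 ?(ltW D0) ?exprn_ge0//=.
rewrite ler_pdivrMr; last by rewrite mulr_gt0// (lt_le_trans _ q1).
by rewrite ler_peMr ?(ltW D0)//; move: q1; lra.
Qed.

Let freq_lattice (i : 'I_n) (l : 'I_(ex_L i)) : (i < N)%N ->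
  0 <= freq (ex_th i) ex_D l <= (8 * nR)^-1.
Proof.
move=> iN; have /andP[t0 tD] := th_lattice iN.
rewrite /freq addr_ge0 ?mulr_ge0 ?(ltW D0)//=.
have lM : (l : nat)%:R + 1 <= MR.
  rewrite natr1 ler_nat; have := ltn_ord l.
  by rewrite {2}/ex_L iN.
rewrite -DM; apply: (@le_trans _ _ (ex_D * (l%:R + 1))).
  by rewrite mulrDr mulr1 addrC lerD2l.
by rewrite ler_wpM2l// ltW.
Qed.

Let freq_single (i : 'I_n) (l : 'I_(ex_L i)) : (i < N)%N = false ->
  freq (ex_th i) ex_D l = ex_th i.
Proof.
move=> iN; have := ltn_ord l; rewrite {2}/ex_L iN ltnS leqn0 => /eqP l0.
by rewrite /freq l0 mulr0 addr0.
Qed.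

(** The frequencies and the half-widths each use half of the allowance, [1 / (4 * n)]. *)
Lemma ex_freq_le (i : 'I_n) (l : 'I_(ex_L i)) :
  `|freq (ex_th i) ex_D l| + ex_lam i <= (2 * n%:R)^-1.
Proof.
have n2 : (2 * n%:R)^-1 = (4 * nR)^-1 + (4 * nR)^-1 by rewrite -/nR; field; rewrite gt_eqF.
have n8 : (8 * nR)^-1 <= (4 * nR)^-1.
  by rewrite lef_pV2 ?posrE ?d4 ?d8//; move: n0; lra.
have c2n : ex_c2 <= (4 * nR)^-1.
  by rewrite lef_pV2 ?posrE ?d4 ?d16//; move: n0; rewrite /nR; lra.
rewrite n2; apply: lerD.
  have [iN|iN] := boolP (i < N)%N.
    by have /andP[f0 f1] := freq_lattice l iN; rewrite ger0_norm// (le_trans f1).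
  rewrite (freq_single l (negbTE iN)) /ex_th (negbTE iN); case: ifP => _.
    by rewrite normrN ger0_norm// invr_ge0 mulr_ge0.
  by rewrite normr0 invr_ge0 mulr_ge0// ltW.
rewrite /ex_lam; case: ifP => _; rewrite ler_pdivrMr ?exprn_gt0//.
  by rewrite (le_trans c2n)// ler_peMr ?invr_ge0 ?mulr_ge0 ?exprn_ege1.
by rewrite (le_trans c1_small)// ler_peMr ?invr_ge0 ?mulr_ge0.
Qed.

Lemma ex_separated i : (ex_L i <= 1)%N \/ 2 * ex_lam i <= ex_D.
Proof.
rewrite /ex_L /ex_lam; case: ifP => iN; [right|by left].
have XM : MR <= ex_X ^+ 2 by rewrite (le_trans MX)// expr2 ler_peMr// ltW.
rewrite mulrA ler_pdivrMr ?exprn_gt0//.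
apply: (@le_trans _ _ (ex_D * MR)); last by rewrite ler_pM2l.
rewrite DM /ex_c2 -/nR le_eqVlt; apply/orP; left; apply/eqP; field.
by rewrite gt_eqF.
Qed.

Lemma ex_b_ge0 i : 0 <= ex_b i.
Proof.
by rewrite /ex_b; case: ifP => _; rewrite ltW// divr_gt0// exprn_gt0.
Qed.

Let nX : 8 * nR <= ex_X.
Proof.
have : nR <= nR ^+ 2 * QR.
  by rewrite expr2 -mulrA ler_peMr ?(ltW n0)// mulr_ege1.
by move: M_ge MX n0; rewrite -mulrA; lra.
Qed.

Let b_le i : ex_b i <= ex_X ^+ 2 / (8 * nR).
Proof.
rewrite /ex_b; case: ifP => _ //; rewrite ler_pdivlMr ?mulr_gt0// expr2.
by rewrite ler_pM2l.
Qed.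

(** The factor [M ^+ N] from the digits and [M ^+ 2] from [ex_D] combine to [ex_X]: the search for a
    good time lasts about as long as the moving packet takes to pass a point. *)
Let window_le : (32 * M)%:R ^+ N * (2 * pi / ex_D ^+ 2) <= 512 * (nR ^+ 2 * QR) * ex_X.
Proof.
have -> : (32 * M)%:R ^+ N * (2 * pi / ex_D ^+ 2) = pi * (128 * (nR ^+ 2 * QR) * ex_X).
  by rewrite -window_identity /ex_D exprVn invrK natrM exprMn.
have -> : 512 * (nR ^+ 2 * QR) * ex_X = 4 * (128 * (nR ^+ 2 * QR) * ex_X).
  by ring.
apply: ler_wpM2r; last exact: pi_le4.
apply: mulr_ge0 (ltW X0); apply: mulr_ge0 => [|]; first exact: ler0n.
exact: le_trans nQ1.
Qed.

(** The constant 1024 in [M_big] is twice the 512 of [window_le]. *)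
Let half_X2 : 512 * (nR ^+ 2 * QR) * ex_X <= ex_X ^+ 2 / 2.
Proof.
have h : 512 * (nR ^+ 2 * QR) <= ex_X / 2 by move: M_ge MX; rewrite -mulrA; lra.
rewrite (_ : ex_X ^+ 2 / 2 = ex_X / 2 * ex_X); last by ring.
by rewrite ler_pM2r.
Qed.

Let lam_sq_le (t c y : R) : t <= ex_X ^+ 2 -> 0 < c -> c <= 4^-1 -> ex_X <= y ->
  t * (c / y) ^+ 2 <= 4^-1.
Proof.
move=> tX c0 c4 Xy; have yp : 0 < y by exact: lt_le_trans Xy.
rewrite exprMn exprVn mulrA ler_pdivrMr ?exprn_gt0//.
have ty : t <= y ^+ 2.
  by apply: (le_trans tX); rewrite lerXn2r ?nnegrE ?(ltW X0) ?(ltW yp).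
have c2 : c ^+ 2 <= 4^-1.
  have c1 : c <= 1 by lra.
  by rewrite expr2; apply: le_trans c4; rewrite ler_piMl ?(ltW c0).
have c2' := sqr_ge0 c; have y2' := sqr_ge0 y.
apply: (@le_trans _ _ (y ^+ 2 * c ^+ 2)); first exact: ler_wpM2r.
by rewrite mulrC; apply: ler_wpM2r.
Qed.

(** The value of [ex_c1] is fixed here: a time offset within the window moves the packet by a
    distance that turns the phase by at most [1 / 2]. *)
Let drift_le (u : R) : `|u| <= 512 * (nR ^+ 2 * QR) * ex_X ->
  `|u / (2 * nR)| * (ex_c1 / ex_X) <= 2^-1.
Proof.
move=> uW; have n2 : 0 < 2 * nR by rewrite mulr_gt0.
have nX0 := mulr_gt0 n2 X0.
rewrite normrM normfV (gtr0_norm n2) mulrACA -invfM ler_pdivrMr//.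
apply: (@le_trans _ _ (512 * (nR ^+ 2 * QR) * ex_X * ex_c1)).
  by rewrite ler_pM2r.
have -> : 512 * (nR ^+ 2 * QR) * ex_X * ex_c1 = ex_c1 * (512 * nR * QR) * (nR * ex_X).
  by ring.
rewrite c1E.
rewrite (_ : 2^-1 * (2 * nR * ex_X) = 1 * (nR * ex_X)); last by field.
exact: lexx.
Qed.

(* The time [t] is a multiple of [tau = 2 * pi / ex_D ^+ 2] in the window of
   length [W] after the time [ts] at which the moving packet is centered at
   coordinate [N] of [x]. *)
Lemma ex_box (x : Rn R n) : (forall i, 0 < tnth x i <= ex_b i) ->
  eball origin (ex_X ^+ 2) x /\ exists2 t, 0 < t <= ex_X ^+ 2 &
    forall i, aligned ex_lam ex_th ex_D ex_L (tnth x i) t i.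
Proof.
move=> xb; have X20 : 0 < ex_X ^+ 2 by rewrite exprn_gt0.
have x_le i : tnth x i <= ex_X ^+ 2 / (8 * nR).
  by have /andP[_ h] := xb i; exact: le_trans h (b_le i).
have x_gt0 i : 0 < tnth x i by have /andP[] := xb i.
split.
  apply: edist_lt => // i; rewrite [tnth origin i]tnth_mktuple subr0 gtr0_norm//.
  apply: (le_lt_trans (x_le i)); rewrite ltr_pM2l// ltf_pV2 ?posrE ?mulr_gt0//.
  by rewrite -/nR; move: n0; lra.
have pi0 : 0 < pi :> R by exact: pi_gt0.
have BN0 : (0 < 32 * M)%N by rewrite muln_gt0/= -(ltr_nat R).
pose iN := Ordinal Nn; pose tau : R := 2 * pi / ex_D ^+ 2.
have tau0 : 0 < tau by rewrite divr_gt0 ?mulr_gt0 ?exprn_gt0.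
pose ts := 2 * nR * tnth x iN.
have ts0 : 0 <= ts by rewrite !mulr_ge0 ?ltW.
(* Coordinates measured in lattice steps [2 * pi / ex_D]; the default 0 extends them to all
   indices. *)
pose y j := nth 0 x j * ex_D / (2 * pi).
have y0 j : 0 <= y j.
  rewrite divr_ge0 ?mulr_ge0 ?(ltW D0) ?(ltW pi0)//.
  have [jn|jn] := ltnP j n; last by rewrite nth_default ?size_tuple.
  by have := x_gt0 (Ordinal jn); rewrite (tnth_nth 0) => /ltW.
(* The search starts at the first multiple of [tau] beyond [ts], so that [t] exceeds [ts] by at most
   [W]. *)
have [k /andP[k0k kB] hk] := digits_approx N (Num.truncn (ts / tau)).+1 BN0 y0.
pose t := k%:R * tau.
have ts_t : ts < t.
  rewrite -ltr_pdivrMr//; apply: lt_le_trans (truncnS_gt _) _.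
  by rewrite ler_nat.
pose W := (32 * M)%:R ^+ N * tau.
have t_ts : t <= ts + W.
  rewrite /t /W (_ : ts + _ = (ts / tau + (32 * M)%:R ^+ N) * tau); last first.
    by rewrite mulrDl divfK// gt_eqF.
  rewrite ler_pM2r//.
  have : (k <= Num.truncn (ts / tau) + (32 * M) ^ N)%N by rewrite -ltnS -addSn.
  rewrite -(ler_nat R) natrD natrX => h; apply: le_trans h _; rewrite lerD2r.
  by rewrite truncn_le divr_ge0// ltW.
have WX : W <= 512 * (nR ^+ 2 * QR) * ex_X by exact: window_le.
(* The center time is at most a quarter of the radius and the window at most half of it. *)
have tX : t <= ex_X ^+ 2.
  have ts_le : ts <= ex_X ^+ 2 / 4.
    apply: (@le_trans _ _ (2 * nR * (ex_X ^+ 2 / (8 * nR)))).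
      by apply: ler_wpM2l; rewrite ?x_le// mulr_ge0// ltW.
    by rewrite le_eqVlt; apply/orP; left; apply/eqP; field; rewrite gt_eqF.
  move: t_ts WX ts_le half_X2; lra.
have t0 : 0 < t by exact: le_lt_trans ts_t.
exists t; first by rewrite t0.
move=> i; exists (tnth x i * ex_th i + t * ex_th i ^+ 2) => l xi.
have [iN'|iN'] := boolP (i < N)%N; last first.
  rewrite (freq_single l (negbTE iN')) /ex_lam (negbTE iN') => hxi.
  apply: (single_frequency_phase (ltW t0) _ _ hxi); last first.
    by have := lam_sq_le tX c10 c1_le (lexx _); lra.
  rewrite /ex_th (negbTE iN'); case: ifPn => [/eqP iE|iNE].
    have -> : i = iN by apply: val_inj.
    (* The displacement from the moving packet is its velocity times the time offset. *)
    have -> : tnth x iN + 2 * t * - (4 * n%:R)^-1 = (ts - t) / (2 * nR).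
      by rewrite /ts -/nR; field; rewrite gt_eqF.
    have tst : `|ts - t| <= W by rewrite distrC gtr0_norm ?subr_gt0//; move: t_ts; lra.
    exact: (drift_le (le_trans tst WX)).
  rewrite mulr0 addr0 gtr0_norm// mulrA ler_pdivrMr//.
  have xX : tnth x i <= ex_X.
    by have /andP[_] := xb i; rewrite /ex_b ltnS leq_eqVlt (negbTE iNE) (negbTE iN').
  rewrite mulrC; apply: ler_pM => //; [exact: ltW|exact: ltW|].
  by move: c1_le; lra.
have [z hz] := hk _ iN'.
rewrite {1}/freq => hxi.
have q1 : 1 <= (32 * M)%:R ^+ i.+1 :> R.
  by rewrite exprn_ege1// natrM -/MR; move: M1; lra.
have q0 : (32 * M)%:R ^+ i.+1 != 0 :> R by rewrite gt_eqF// (lt_le_trans _ q1).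
have /andP[f0 f1] := freq_lattice l iN'.
have lM : (l : nat)%:R <= MR.
  by rewrite ler_nat; have := ltn_ord l; rewrite {2}/ex_L iN' => /ltnW.
move: hz; rewrite /y -(tnth_nth 0 x i) => hz.
apply: (lattice_phase (ltW t0) D0 (k := k) (z := z) _ _ q0 erefl _ _ _ hxi).
- by rewrite /t /tau; move: (pi : R) => P; field; rewrite gt_eqF.
- by rewrite /ex_th iN'; field.
(* This fixes the base [32 * M]: with [pi <= 4] and [l <= M] the lattice error turns the phase by at
   most [8 * M / (32 * M) = 1 / 4]. *)
- apply: (@le_trans _ _ (2 * 4 * MR * (32 * M)%:R^-1)).
    apply: ler_pM => //; first by rewrite !mulr_ge0// ltW.
    apply: ler_pM => //; first by rewrite mulr_ge0// ltW.
    by rewrite ler_pM2l//; exact: pi_le4.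
  by rewrite natrM -/MR le_eqVlt; apply/orP; left; apply/eqP; field; rewrite gt_eqF.
- have f01 : freq (ex_th i) ex_D l <= 1.
    by rewrite (le_trans f1)// invf_le1//; move: nR1; lra.
  have xX2 : tnth x i <= ex_X ^+ 2.
    apply: (le_trans (x_le i)); rewrite ler_pdivrMr// ler_peMr ?(ltW X20)//.
    by move: nR1; lra.
  have t2 : 0 <= 2 * t by rewrite mulr_ge0// ltW.
  have s0 : 0 <= tnth x i + 2 * t * (ex_th i + ex_D * l%:R).
    by apply: addr_ge0; [exact: ltW|exact: (mulr_ge0 t2 f0)].
  rewrite /ex_lam iN' mulrA ler_pdivrMr// (ger0_norm s0).
  (* The position contributes at most [ex_X ^+ 2] and the drift at most twice that, since the
     frequency is at most 1; and [3 / 16 <= 1 / 2]. *)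
  apply: (@le_trans _ _ (ex_X ^+ 2 * 3 * 16^-1)); last first.
    by rewrite -mulrA mulrC; apply: ler_wpM2r; [exact: ltW|lra].
  apply: ler_pM => //; first exact: ltW.
  have : t * freq (ex_th i) ex_D l <= ex_X ^+ 2 * 1 by apply: ler_pM => //; exact: ltW.
  rewrite /freq; move: xX2; lra.
- rewrite /ex_lam iN'; apply: lam_sq_le => //; first by apply: le_trans c2_le _; lra.
  by rewrite expr2 ler_peMr// ltW.
Qed.

End example.

(** * Comparison of powers of [M] *)

(** Otherwise [M ^ (e - e')] would stay below [b / a], although it exceeds [K] as soon as [M]
    exceeds [K ^ (1 / (e - e'))]. *)
Lemma powR_growth (R : realType) (a b e e' : R) (M0 : nat) : 0 < a ->
  (forall M : nat, (M0 <= M)%N -> a * M%:R `^ e <= b * M%:R `^ e') -> e <= e'.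
Proof.
move=> a0 h; rewrite leNgt; apply/negP => ee'.
have d0 : 0 < e - e' by rewrite subr_gt0.
pose K := `|b / a| + 1; have K0 : 0 < K by rewrite ltr_wpDl.
pose M := maxn M0 (Num.truncn (K `^ (e - e')^-1)).+1.
have MK : K `^ (e - e')^-1 < M%:R.
  by apply: lt_le_trans (truncnS_gt _) _; rewrite ler_nat leq_maxr.
have Mp : 0 < M%:R :> R by apply: le_lt_trans MK; rewrite powR_ge0.
have := h M (leq_maxl _ _); apply/negP; rewrite -ltNge.
have -> : M%:R `^ e = M%:R `^ (e - e') * M%:R `^ e'.
  by rewrite -powRD ?subrK// (gt_eqF Mp) implybT.
rewrite mulrA ltr_pM2r ?powR_gt0//.
have : K < M%:R `^ (e - e').
  have := gt0_ltr_powR d0 (powR_ge0 _ _) (ltW Mp) MK.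
  by rewrite -powRrM mulVf ?gt_eqF// powRr1 // ltW.
move=> KM; rewrite -ltr_pdivrMl// mulrC; apply: le_lt_trans KM.
by rewrite /K ler_wpDr// ler_norm.
Qed.

Section constants.
Variables (R : realType) (n N : nat).
Hypothesis Nn : (N < n)%N.

Let n_gt0 : (0 < n)%N. Proof. exact: leq_ltn_trans Nn. Qed.

Lemma ex_c2_gt0 : 0 < ex_c2 n :> R.
Proof. by rewrite invr_gt0 mulr_gt0 ?ltr0n. Qed.

Lemma ex_c1_gt0 : 0 < ex_c1 n N :> R.
Proof. by rewrite invr_gt0 !mulr_gt0 ?ltr0n ?exprn_gt0. Qed.

Definition tensor_const : R := @fourier_real R n * @tcomb_cst R n * (2^-1 * tent_mass) ^+ n.

Lemma tensor_const_gt0 : 0 < tensor_const.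
Proof.
apply: mulr_gt0; first exact: (mulr_gt0 fourier_real_gt0 tcomb_cst_gt0).
by rewrite exprn_gt0// mulr_gt0 ?tent_mass_gt0.
Qed.

(** Gathers all factors of the lower bound that do not depend on [M], so that only powers of [M]
    remain to be compared. *)
Definition lower_const (p : R) : R := tensor_const *
  Num.sqrt (ex_c2 n ^+ N * ex_c1 n N ^+ (n - N)) * ((8 * n%:R)^-1 ^+ N.+1) `^ p^-1.

Lemma lower_const_gt0 p : 0 < lower_const p.
Proof.
apply: mulr_gt0; first apply: mulr_gt0; first exact: tensor_const_gt0.
- by rewrite sqrtr_gt0 mulr_gt0 ?exprn_gt0 ?ex_c1_gt0 ?ex_c2_gt0.
- by rewrite powR_gt0// exprn_gt0// invr_gt0 mulr_gt0 ?ltr0n.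
Qed.

End constants.

Section exponents_of_example.
Context {R : realType}.
Variables (n N M : nat).
Hypothesis Nn : (N < n)%N.
Hypothesis M_big : (1024 * n ^ 2 * 32 ^ N <= M)%N.
Notation J0 := (@fejer2_mass R).
Notation T := (@tent_mass R).
Let m : R := M%:R.
Let q : R := N%:R + 2.

Let n_gt0 : (0 < n)%N. Proof. exact: leq_ltn_trans Nn. Qed.

Let M_gt0 : (0 < M)%N.
Proof. by apply: leq_trans M_big; rewrite !muln_gt0 !expn_gt0 n_gt0. Qed.

Let m0 : 0 < m. Proof. by rewrite ltr0n. Qed.

Let lam0 := ex_lam_gt0 (R := R) Nn M_big.

(** Up to constants this is both the squared norm of the datum and the size of the solution on the
    box; their quotient therefore leaves one square root. *)
Definition bumps : R := \prod_(i < n) ((ex_L N M i)%:R * ex_lam N M i).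
Definition volume : R := \prod_(i < n) (ex_b N M i - 0).

Let powX (k : nat) (e : R) : (m `^ e) ^+ k = m `^ (e * k%:R).
Proof. by rewrite -powR_mulrn ?powR_ge0// powRrM. Qed.

Let mD (a b : R) : m `^ (a + b) = m `^ a * m `^ b.
Proof. by rewrite powRD// (gt_eqF m0) implybT. Qed.

Let XE : ex_X N M = m `^ q.
Proof. by rewrite /ex_X /q -natrD addn2 powR_mulrn// ltW. Qed.

Let X2E : (ex_X N M : R) ^+ 2 = m `^ (2 * q).
Proof. by rewrite XE powX mulrC. Qed.

Lemma bumpsE : bumps = ex_c2 n ^+ N * ex_c1 n N ^+ (n - N) *
  m `^ (N%:R * (1 - 2 * q) - (n%:R - N%:R) * q).
Proof.
transitivity (\prod_(i < n) (if (i < N)%N then ex_c2 n * m `^ (1 - 2 * q) else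
    ex_c1 n N * m `^ (- q))).
  apply: eq_bigr => i _; rewrite /ex_L /ex_lam; case: ifP => _.
    by rewrite X2E mD powRr1 ?(ltW m0)// powRN mulrCA.
  by rewrite mul1r XE powRN.
rewrite prod_if_lt ?(ltnW Nn)// !exprMn !powX mulrACA -mD natrB ?(ltnW Nn)//.
by congr (_ * m `^ _); ring.
Qed.

Lemma volumeE : volume = (8 * n%:R)^-1 ^+ N.+1 *
  m `^ (2 * q * (N%:R + 1) + (n%:R - N%:R - 1) * q).
Proof.
transitivity (\prod_(i < n)
  (if (i < N.+1)%N then (8 * n%:R)^-1 * m `^ (2 * q) else m `^ q)).
  apply: eq_bigr => i _; rewrite subr0 /ex_b; case: ifP => _; last exact: XE.
  by rewrite X2E mulrC.
rewrite prod_if_lt// !exprMn !powX -[LHS]mulrA -mD natrB// -natr1.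
by congr (_ * m `^ _); ring.
Qed.

Lemma bumps_gt0 : 0 < bumps.
Proof.
by rewrite bumpsE !mulr_gt0 ?exprn_gt0 ?powR_gt0 ?(ex_c1_gt0 R Nn) ?(ex_c2_gt0 R Nn).
Qed.

(** The test inequality with all quantities written as powers of [M], using that the radius is
    [M ^ (2 * q)]. *)
Lemma example_inequality (p gamma eps C : R) : 0 < p -> 0 < C ->
  (forall (r : R) (f fhat : Rn R n -> R[i]),
      1 < r -> is_fourier f fhat -> ess_supp fhat `<=` eball origin 1 ->
      ('N[lebesgue_Rn R n]_(p%:E) [schrodinger_max fhat r \_ (eball origin r)]
         <= (C * r `^ eps * r `^ gamma)%:E * cLnorm 2%:E f)%E) ->
  lower_const n N p * m `^ ((N%:R * (1 - 2 * q) - (n%:R - N%:R) * q) / 2 +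
      (2 * q * (N%:R + 1) + (n%:R - N%:R - 1) * q) / p) <=
  C * Num.sqrt (J0 ^+ n) * m `^ (2 * q * (gamma + eps)).
Proof.
move=> p0 C0 est.
pose A : R := @fourier_real R n * (@tcomb_cst R n *
  \prod_(i < n) (2^-1 * ((ex_L N M i)%:R * ex_lam N M i * T))).
have AE : A = tensor_const R n * bumps.
  rewrite /A mulrA /tensor_const -[in RHS]mulrA; congr (_ * _).
  rewrite /bumps -[(2^-1 * T) ^+ n](_ : \prod_(i < n) (2^-1 * T) = _); last first.
    by rewrite prodr_const card_ord.
  by rewrite -big_split/=; apply: eq_bigr => i _; ring.
have A0 : 0 < A by rewrite AE mulr_gt0 ?bumps_gt0 ?tensor_const_gt0.
have r1 : 1 < (ex_X N M : R) ^+ 2.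
  have M1 : 1 < M%:R :> R.
    rewrite ltr1n; apply: leq_trans M_big; rewrite -mulnA.
    by apply: (@leq_trans 1024) => //; rewrite leq_pmulr// muln_gt0 !expn_gt0 n_gt0.
  by rewrite /ex_X !exprn_egt1.
have box (x : Rn R n) : (forall i, 0 < tnth x i <= ex_b N M i) ->
    eball origin (ex_X N M ^+ 2) x /\ exists2 t, 0 < t <= (ex_X N M : R) ^+ 2 &
    A <= Normc.normc (schrodinger
      (tcomb (ex_lam N M) (ex_th N M) (ex_D n M) (ex_L N M)) t x).
  move=> /(ex_box Nn M_big)[xr [t t0 al]]; split => //; exists t => //.
  exact: schrodinger_lower_bound.
have := maximal_estimate_test lam0 p0 A0 (@ex_b_ge0 R n N M Nn M_big)
  (est _ _ _ r1 (is_fourier_tpacket (ex_th (R := R) N M) (ex_D n M) (ex_L N M) lam0)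
    (ess_supp_tcomb n_gt0 lam0 (@ex_freq_le R n N M Nn M_big)))
  (@ex_separated R n N M Nn M_big) box.
rewrite -/volume AE big_split/= -/bumps prodr_const card_ord sqrtrM ?(ltW bumps_gt0)//.
set sP := Num.sqrt bumps; have sP0 : 0 < sP by rewrite sqrtr_gt0 bumps_gt0.
(* Writing [bumps] as the square of [sP] allows one factor [sP] to be cancelled against the norm of
   the datum. *)
rewrite -{1}(sqr_sqrtr (ltW bumps_gt0)) -/sP.
set F := tensor_const R n.
rewrite (_ : F * _ * _ = F * sP * volume `^ p^-1 * sP); last by ring.
rewrite (_ : C * _ * _ * _ = C * Num.sqrt (J0 ^+ n) *
  ((ex_X N M ^+ 2) `^ gamma * (ex_X N M ^+ 2) `^ eps) * sP); last by ring.
rewrite ler_pM2r//; congr (_ <= _).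
- have k1 : 0 <= ex_c2 n ^+ N * ex_c1 n N ^+ (n - N) :> R.
    by rewrite mulr_ge0 ?exprn_ge0 ?(ltW (ex_c1_gt0 R Nn)) ?(ltW (ex_c2_gt0 R Nn)).
  have k2 : 0 <= (8 * n%:R)^-1 ^+ N.+1 :> R by rewrite exprn_ge0// invr_ge0 mulr_ge0.
  rewrite /sP bumpsE volumeE sqrtrM// -(powR12_sqrt (powR_ge0 m _)) -powRrM.
  by rewrite powRM ?powR_ge0// -powRrM mD /lower_const -/F; ring.
- by rewrite X2E -!powRrM -mD -mulrDr.
Qed.

End exponents_of_example.

(** * Lower bounds for the exponent and the two thresholds *)

(** The example with [N = m - 1]: [powR_growth] compares the exponents of [M], division by
    [2 * (N + 2)] converts them into exponents of the radius, and [eps] is arbitrary. *)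
Lemma maximal_estimate_lower (R : realType) (n N : nat) (p gamma : R) :
  (N < n)%N -> 0 < p -> maximal_estimate n p gamma ->
  (N%:R + 1) / (2 * (N%:R + 2)) - (n%:R + N%:R + 1) / 2 * (2^-1 - p^-1) <= gamma.
Proof.
move=> Nn p0 est; apply/ler_addgt0Pl => eps eps0.
have [C C0 /(@example_inequality R n N _ Nn _ p gamma eps C p0 C0) h] := est _ eps0.
have := powR_growth (lower_const_gt0 Nn p) h.
have q0 : 0 < N%:R + 2 :> R by rewrite ltr_wpDl.
have -> : (N%:R + 1) / (2 * (N%:R + 2)) - (n%:R + N%:R + 1) / 2 * (2^-1 - p^-1) =
  ((N%:R * (1 - 2 * (N%:R + 2)) - (n%:R - N%:R) * (N%:R + 2)) / 2 +
   (2 * (N%:R + 2) * (N%:R + 1) + (n%:R - N%:R - 1) * (N%:R + 2)) / p) / (2 * (N%:R + 2)).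
  by field; rewrite !gt_eqF.
by move=> h'; rewrite ler_pdivrMr ?mulr_gt0// [leRHS]mulrC [eps + _]addrC.
Qed.

Lemma gamma_bar_lower (R : realType) (n N : nat) (p c : R) :
  (N < n)%N -> 0 < p -> gamma_bar n p = c%:E ->
  (N%:R + 1) / (2 * (N%:R + 2)) - (n%:R + N%:R + 1) / 2 * (2^-1 - p^-1) <= c.
Proof.
move=> Nn p0 gb; rewrite -lee_fin -gb; apply: le_ereal_inf_tmp => _ [g /= eg <-].
by rewrite lee_fin; exact: maximal_estimate_lower.
Qed.

Theorem corollary1p2 (R : realType) (n : nat) (p : R)
    (hn : (3 <= n)%N) (hp : 2 <= p) :
  (gamma_bar n p = (n%:R * (1 / p - n%:R / (2 * (n%:R + 1))))%:E ->
     p <= p0 n) /\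
  (gamma_bar n p = 0%:E -> p1 n <= p).
Proof.
have p_gt0 : 0 < p by apply: lt_le_trans hp.
have n3 : 3 <= n%:R :> R by rewrite (ler_nat R 3).
split=> gb.
  (* The choice [N = n - 2], that is [m = n - 1]. *)
  have Nn : (n.-2 < n)%N by case: (n) hn => [|[|k]].
  have := gamma_bar_lower Nn p_gt0 gb.
  have -> : (n.-2)%:R = n%:R - 2 :> R.
    by case: (n) hn => [|[|k]]// _; rewrite /= -addn2 natrD addrK.
  set u := p^-1 => h; set nr : R := n%:R in h n3 *.
  have u0 : 0 < u by rewrite invr_gt0.
  (* The inverse of [p0 n]. As functions of [u = 1 / p] the two sides of [h] have slopes [n - 1 / 2]
     and [n], so [h] says [0 <= (u - K) / 2]. *)
  pose K := (nr - 1) * (nr + 2) / (2 * nr * (nr + 1)).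
  have Ku : K <= u.
    have : 0 <= (u - K) / 2.
      move: h; rewrite -subr_ge0 div1r -/u; congr (0 <= _); rewrite /K; field.
      by apply/andP; split; rewrite gt_eqF//; lra.
    by lra.
  have n1 : 0 < nr - 1 by lra.
  have p0E : p0 n * K = 1 :> R.
    rewrite /p0 /K -/nr; field.
    by apply/and4P; split; rewrite gt_eqF//; lra.
  have p00 : 0 < p0 n :> R.
    by rewrite /p0 -/nr addr_gt0// divr_gt0// mulr_gt0//; lra.
  by rewrite -[leLHS]invrK -/u -div1r ler_pdivrMr// -p0E ler_pM2l.
rewrite /p1.
have term (k : nat) : (0 < k <= n)%N -> p1_term n k <= p.
  case: k => // N /andP[_ Nn]; have := gamma_bar_lower Nn p_gt0 gb.
  have kE : N.+1%:R = N%:R + 1 :> R by rewrite natr1.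
  set u := p^-1; rewrite /p1_term kE; set k : R := N%:R; set nr : R := n%:R in n3 * => h.
  have k0 : 0 <= k by exact: ler0n.
  have u0 : 0 < u by rewrite invr_gt0.
  set P := 2 + _.
  have d0 : 0 < nr - 1 + (k + 1) + nr / (k + 1).
    by rewrite addr_gt0 ?divr_gt0//; lra.
  have P0 : 0 < P by rewrite /P addr_gt0// divr_gt0.
  (* The inverse of [P], and the zero of the left side of [h], which is affine in [u] with slope
     [(n + k + 1) / 2]. *)
  pose K := 2^-1 - (k + 1) / ((k + 2) * (nr + k + 1)).
  have uK : u <= K.
    have : (nr + k + 1) / 2 * (u - K) <= 0.
      move: h; congr (_ <= 0); rewrite /K; field.
      by apply/andP; split; rewrite gt_eqF//; lra.
    by rewrite pmulr_rle0 ?subr_le0// divr_gt0//; lra.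
  have PK : P * K = 1.
    rewrite /P /K; field.
    by apply/and4P; split; rewrite gt_eqF//; nra.
  by rewrite -[leRHS]invrK -/u -div1r ler_pdivlMr// -PK ler_pM2l.
(* The term [m = 1] is also the initial value of the iterated maximum. *)
have p1p : p1_term n 1 <= p by apply: term; rewrite (leq_trans _ hn).
rewrite big_nat; apply: (big_ind (fun z => z <= p)) => //.
- by move=> x y xp yp; rewrite ge_max xp.
Qed.
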